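(* Let $d\geq1$ be an odd integer and let $k_0,k_1,k_2,k_3$ be nonzero scalars in $\mathbb{F}$ with $k_0^2=q^{-d-1}$. The $\mathfrak{H}_q$-module $E(k_0,k_1,k_2,k_3)$ is irreducible if and only if the following conditions hold: (i) $q^i\neq1$ for all $i=2,4,\ldots,d-1$. (ii) $k_0^2\neq q^{-i}$ for all $i=2,4,\ldots,d-1$. (iii) $k_0k_1k_2k_3,\ k_0k_1^{-1}k_2k_3,\ k_0k_1k_2^{-1}k_3,\ k_0k_1k_2k_3^{-1}\neq q^{-i}$ for all $i=1,3,\ldots,d$.
   Context: $\mathbb{F}$ is a field and $q\in\mathbb{F}$ is nonzero. The universal DAHA $\mathfrak{H}_q$ of type $(C_1^\vee,C_1)$ is the unital associative $\mathbb{F}$-algebra with generators $t_0^{\pm1},t_1^{\pm1},t_2^{\pm1},t_3^{\pm1}$ and relations: $t_it_i^{-1}=t_i^{-1}t_i=1$ for all $i$; $t_i+t_i^{-1}$ is central for all $i$; $t_0t_1t_2t_3=q^{-1}$. For an odd integer $d\ge1$ and nonzero $k_0,k_1,k_2,k_3\in\mathbb{F}$ with $k_0^2=q^{-d-1}$, $E(k_0,k_1,k_2,k_3)$ denotes the $(d+1)$-dimensional $\mathfrak{H}_q$-module with $\mathbb{F}$-basis $\{v_i\}_{i=0}^d$ and action - $t_0v_i=k_0^{-1}q^{-i}(1-q^i)(1-k_0^2q^i)v_{i-1}+(k_0+k_0^{-1}-k_0^{-1}q^{-i})v_i$ for $i=2,4,\ldots,d-1$; $t_0v_i=k_0^{-1}q^{-i-1}(v_i-v_{i+1})$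 for $i=1,3,\ldots,d-2$; $t_0v_0=k_0v_0$; $t_0v_d=k_0v_d$; - $t_1v_i=-k_1(1-q^i)(1-k_0^2q^i)v_{i-1}+k_1v_i+k_1^{-1}v_{i+1}$ for $i=2,4,\ldots,d-1$; $t_1v_i=k_1^{-1}v_i$ for $i=1,3,\ldots,d$; $t_1v_0=k_1v_0+k_1^{-1}v_1$; - $t_2v_i=k_0^{-1}k_1^{-1}k_3^{-1}q^{-i-1}(v_i-v_{i+1})$ for $i=0,2,\ldots,d-1$; $t_2v_i=\frac{(k_0k_1k_3q^i-k_2)(k_0k_1k_3q^i-k_2^{-1})}{k_0k_1k_3q^i}v_{i-1}+(k_2+k_2^{-1}-k_0^{-1}k_1^{-1}k_3^{-1}q^{-i})v_i$ for $i=1,3,\ldots,d$; - $t_3v_i=k_3v_i$ for $i=0,2,\ldots,d-1$; $t_3v_i=-k_3^{-1}(k_0k_1k_3q^i-k_2)(k_0k_1k_3q^i-k_2^{-1})v_{i-1}+k_3^{-1}v_i+k_3v_{i+1}$ for $i=1,3,\ldots,d-2$; $t_3v_d=-k_3^{-1}(k_0k_1k_3q^d-k_2)(k_0k_1k_3q^d-k_2^{-1})v_{d-1}+k_3^{-1}v_d$. (These formulas do define an $\mathfrak{H}_q$-module.) *)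

(* Defs.v *)
From HB Require Import structures.
From mathcomp Require Import all_boot all_order all_algebra.
From mathcomp Require Import generic_quotient boolp.
From mathcomp Require Import ring.

Set Implicit Arguments.
Unset Strict Implicit.
Unset Printing Implicit Defensive.

Import GRing.Theory.
Local Open Scope ring_scope.
Local Open Scope quotient_scope.

(* Unital associative F-algebras presented by generators X and relations R:   *)
(* formal expressions modulo the smallest congruence [pcong] containing R and *)
(* the F-algebra axioms. [PConst c] stands for the scalar c times the unit.   *)

Inductive pterm (F X : Type) : Type :=
  | PGen of X
  | PConst of F
  | POpp of pterm F X
  | PAdd of pterm F X & pterm F X
  | PMul of pterm F X & pterm F X.
Arguments PGen {F X}.
Arguments PConst {F X}.

HB.instance Definition _ (F X : Type) := gen_eqMixin (pterm F X).
HB.instance Definition _ (F X : Type) := gen_choiceMixin (pterm F X).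

Section Presentation.
Variables (F : fieldType) (X : Type) (R : pterm F X -> pterm F X -> Prop).
Local Notation term := (pterm F X).
Implicit Types (x y z : term) (c : F).

Inductive pcong : term -> term -> Prop :=
  | pcong_rel x y of R x y : pcong x y
  | pcong_refl x : pcong x x
  | pcong_sym x y of pcong x y : pcong y x
  | pcong_trans x y z of pcong x y & pcong y z : pcong x z
  | pcong_opp x y of pcong x y : pcong (POpp x) (POpp y)
  | pcong_add x x' y y' of pcong x x' & pcong y y' :
      pcong (PAdd x y) (PAdd x' y')
  | pcong_mul x x' y y' of pcong x x' & pcong y y' :
      pcong (PMul x y) (PMul x' y')
  | pcong_addA x y z : pcong (PAdd x (PAdd y z)) (PAdd (PAdd x y) z)
  | pcong_addC x y : pcong (PAdd x y) (PAdd y x)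
  | pcong_add0 x : pcong (PAdd (PConst 0) x) x
  | pcong_addN x : pcong (PAdd (POpp x) x) (PConst 0)
  | pcong_mulA x y z : pcong (PMul x (PMul y z)) (PMul (PMul x y) z)
  | pcong_mul1l x : pcong (PMul (PConst 1) x) x
  | pcong_mul1r x : pcong (PMul x (PConst 1)) x
  | pcong_mulDl x y z :
      pcong (PMul (PAdd x y) z) (PAdd (PMul x z) (PMul y z))
  | pcong_mulDr x y z :
      pcong (PMul x (PAdd y z)) (PAdd (PMul x y) (PMul x z))
  | pcong_constD c c' : pcong (PConst (c + c')) (PAdd (PConst c) (PConst c'))
  | pcong_constM c c' : pcong (PConst (c * c')) (PMul (PConst c) (PConst c'))
  | pcong_constC c x : pcong (PMul (PConst c) x) (PMul x (PConst c)).

Definition pcongb x y := `[< pcong x y >].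

Lemma pcongb_equiv : equiv_class_of pcongb.
Proof.
split=> [x | x y | y x z].
- exact/asboolP/pcong_refl.
- by apply/asboolP/asboolP; apply: pcong_sym.
- by move=> /asboolP xy /asboolP yz; apply/asboolP/(pcong_trans xy yz).
Qed.

Canonical pcongb_equiv_rel := EquivRelPack pcongb_equiv.

Definition palg := {eq_quot pcongb}.
HB.instance Definition _ := Choice.on palg.
HB.instance Definition _ := EqQuotient.on palg.

Definition pclass (x : term) : palg := \pi_palg x.
Definition pgen (g : X) : palg := pclass (PGen g).
Definition pconst (c : F) : palg := pclass (PConst c).

Lemma pclassP x y : pclass x = pclass y <-> pcong x y.
Proof.
split; first by move=> /eqmodP/asboolP.
by move=> xy; apply/eqmodP/asboolP.
Qed.

Lemma pcong_repr x : pcong (repr (pclass x)) x.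
Proof. by apply/pclassP; rewrite /pclass reprK. Qed.

Lemma pclassK (a : palg) : pclass (repr a) = a.
Proof. exact: reprK. Qed.

Definition palg_opp (a : palg) := pclass (POpp (repr a)).
Definition palg_add (a b : palg) := pclass (PAdd (repr a) (repr b)).
Definition palg_mul (a b : palg) := pclass (PMul (repr a) (repr b)).

Lemma palg_oppE x : palg_opp (pclass x) = pclass (POpp x).
Proof. by apply/pclassP/pcong_opp/pcong_repr. Qed.
Lemma palg_addE x y : palg_add (pclass x) (pclass y) = pclass (PAdd x y).
Proof. by apply/pclassP/pcong_add; apply: pcong_repr. Qed.
Lemma palg_mulE x y : palg_mul (pclass x) (pclass y) = pclass (PMul x y).
Proof. by apply/pclassP/pcong_mul; apply: pcong_repr. Qed.

Lemma pclassW (P : palg -> Prop) : (forall x, P (pclass x)) -> forall a, P a.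
Proof. by move=> Px a; rewrite -[a]pclassK. Qed.

Let palgE := (palg_oppE, palg_addE, palg_mulE).

Fact palg_addA : associative palg_add.
Proof.
by elim/pclassW=> x; elim/pclassW=> y; elim/pclassW=> z; rewrite !palgE;
  apply/pclassP/pcong_addA.
Qed.
Fact palg_addC : commutative palg_add.
Proof.
by elim/pclassW=> x; elim/pclassW=> y; rewrite !palgE; apply/pclassP/pcong_addC.
Qed.
Fact palg_add0 : left_id (pconst 0) palg_add.
Proof. by elim/pclassW=> x; rewrite !palgE; apply/pclassP/pcong_add0. Qed.
Fact palg_addN : left_inverse (pconst 0) palg_opp palg_add.
Proof. by elim/pclassW=> x; rewrite !palgE; apply/pclassP/pcong_addN. Qed.
Fact palg_mulA : associative palg_mul.
Proof.
by elim/pclassW=> x; elim/pclassW=> y; elim/pclassW=> z; rewrite !palgE;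
  apply/pclassP/pcong_mulA.
Qed.
Fact palg_mul1l : left_id (pconst 1) palg_mul.
Proof. by elim/pclassW=> x; rewrite !palgE; apply/pclassP/pcong_mul1l. Qed.
Fact palg_mul1r : right_id (pconst 1) palg_mul.
Proof. by elim/pclassW=> x; rewrite !palgE; apply/pclassP/pcong_mul1r. Qed.
Fact palg_mulDl : left_distributive palg_mul palg_add.
Proof.
by elim/pclassW=> x; elim/pclassW=> y; elim/pclassW=> z; rewrite !palgE;
  apply/pclassP/pcong_mulDl.
Qed.
Fact palg_mulDr : right_distributive palg_mul palg_add.
Proof.
by elim/pclassW=> x; elim/pclassW=> y; elim/pclassW=> z; rewrite !palgE;
  apply/pclassP/pcong_mulDr.
Qed.

HB.instance Definition _ := GRing.isPzRing.Build palg
  palg_addA palg_addC palg_add0 palg_addN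
  palg_mulA palg_mul1l palg_mul1r palg_mulDl palg_mulDr.

Lemma pclassN x : pclass (POpp x) = - pclass x.
Proof. by rewrite -palg_oppE. Qed.
Lemma pclassD x y : pclass (PAdd x y) = pclass x + pclass y.
Proof. by rewrite -palg_addE. Qed.
Lemma pclassM x y : pclass (PMul x y) = pclass x * pclass y.
Proof. by rewrite -palg_mulE. Qed.

Lemma pconst1 : pconst 1 = 1. Proof. by []. Qed.
Lemma pconstD c c' : pconst (c + c') = pconst c + pconst c'.
Proof. by rewrite -pclassD; apply/pclassP/pcong_constD. Qed.
Lemma pconstM c c' : pconst (c * c') = pconst c * pconst c'.
Proof. by rewrite -pclassM; apply/pclassP/pcong_constM. Qed.
Lemma pconstC c (a : palg) : pconst c * a = a * pconst c.
Proof.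
by elim/pclassW: a => x; rewrite -!pclassM; apply/pclassP/pcong_constC.
Qed.

Definition palg_scale c (a : palg) := pconst c * a.

Fact palg_scaleA c c' a :
  palg_scale c (palg_scale c' a) = palg_scale (c * c') a.
Proof. by rewrite /palg_scale pconstM mulrA. Qed.
Fact palg_scale1 : left_id 1 palg_scale.
Proof. by move=> a; rewrite /palg_scale pconst1 mul1r. Qed.
Fact palg_scaleDr : right_distributive palg_scale +%R.
Proof. by move=> c a b; rewrite /palg_scale mulrDr. Qed.
Fact palg_scaleDl a : {morph palg_scale^~ a : c c' / c + c'}.
Proof. by move=> c c'; rewrite /palg_scale pconstD mulrDl. Qed.

HB.instance Definition _ := GRing.Zmodule_isLmodule.Build F palg
  palg_scaleA palg_scale1 palg_scaleDr palg_scaleDl.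

(* MathComp's algebra structures require 1 != 0, which a presentation need    *)
(* not satisfy; these are the two remaining algebra axioms.                   *)
Lemma palg_scalerAl c (a b : palg) : c *: (a * b) = c *: a * b.
Proof. by rewrite /GRing.scale /= /palg_scale mulrA. Qed.
Lemma palg_scalerAr c (a b : palg) : c *: (a * b) = a * (c *: b).
Proof. by rewrite /GRing.scale /= /palg_scale mulrA pconstC mulrA. Qed.

Section Lift.
Variables (A : algType F) (f : X -> A).

Fixpoint peval x : A :=
  match x with
  | PGen g => f g
  | PConst c => c%:A
  | POpp x => - peval x
  | PAdd x y => peval x + peval y
  | PMul x y => peval x * peval y
  end.

Hypothesis f_rel : forall x y, R x y -> peval x = peval y.

Lemma peval_cong x y : pcong x y -> peval x = peval y.
Proof.
elim=> {x y} //=.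
- by move=> x y z _ -> _ ->.
- by move=> x y _ ->.
- by move=> x x' y y' _ -> _ ->.
- by move=> x x' y y' _ -> _ ->.
- by move=> x y z; rewrite addrA.
- by move=> x y; rewrite addrC.
- by move=> x; rewrite scale0r add0r.
- by move=> x; rewrite scale0r addNr.
- by move=> x y z; rewrite mulrA.
- by move=> x; rewrite scale1r mul1r.
- by move=> x; rewrite scale1r mulr1.
- by move=> x y z; rewrite mulrDl.
- by move=> x y z; rewrite mulrDr.
- by move=> c c'; rewrite scalerDl.
- by move=> c c'; rewrite -scalerAl mul1r scalerA.
- by move=> c x; rewrite mulr_algl mulr_algr.
Qed.

Definition plift of (forall x y, R x y -> peval x = peval y) :=
  fun a : palg => peval (repr a).
Local Notation lift := (plift f_rel).

Lemma plift_class x : lift (pclass x) = peval x.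
Proof. exact/peval_cong/pcong_repr. Qed.

Lemma plift_gen g : lift (pgen g) = f g.
Proof. exact: plift_class. Qed.

Fact plift_is_zmod_morphism : zmod_morphism lift.
Proof.
by elim/pclassW=> x; elim/pclassW=> y; rewrite -pclassN -pclassD !plift_class.
Qed.
Fact plift_is_monoid_morphism : monoid_morphism lift.
Proof.
split; first by rewrite -pconst1 plift_class /= scale1r.
by elim/pclassW=> x; elim/pclassW=> y; rewrite -pclassM !plift_class.
Qed.
Fact plift_is_scalable : scalable lift.
Proof.
move=> c; elim/pclassW=> x; rewrite {1}/GRing.scale /= /palg_scale -pclassM.
by rewrite !plift_class /= mulr_algl.
Qed.

HB.instance Definition _ :=
  GRing.isZmodMorphism.Build palg A lift plift_is_zmod_morphism.
HB.instance Definition _ :=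
  GRing.isMonoidMorphism.Build palg A lift plift_is_monoid_morphism.
HB.instance Definition _ :=
  GRing.isScalable.Build F palg A *:%R lift plift_is_scalable.

End Lift.

End Presentation.

Arguments plift {F X R A f} f_rel _.

(* Since boolp makes every Prop boolean, S ranges over all subsets of V.      *)
Definition irreducible_module (H : pzRingType) (V : lmodType H) : Prop :=
  (exists v : V, v != 0) /\
  forall S : {pred V}, submod_closed S ->
    (forall v, v \in S -> v = 0) \/ (forall v, v \in S).

(* The left H-module of column vectors on which h acts as rho h.              *)
Section MatrixModule.
Variables (F : fieldType) (n : nat) (H : pzRingType).

Definition matrix_module of {rmorphism H -> 'M[F]_n} := 'cV[F]_n.

Variable rho : {rmorphism H -> 'M[F]_n}.
Local Notation V := (matrix_module rho).
HB.instance Definition _ := GRing.Zmodule.copy V 'cV[F]_n.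

Definition matrix_module_scale (h : H) (v : V) : V := rho h *m v.

Fact matrix_module_scaleA h h' v :
  matrix_module_scale h (matrix_module_scale h' v)
    = matrix_module_scale (h * h') v.
Proof. by rewrite /matrix_module_scale rmorphM mulmxA. Qed.
Fact matrix_module_scale1 : left_id 1 matrix_module_scale.
Proof. by move=> v; rewrite /matrix_module_scale rmorph1 mul1mx. Qed.
Fact matrix_module_scaleDr : right_distributive matrix_module_scale +%R.
Proof. by move=> h u v; rewrite /matrix_module_scale mulmxDr. Qed.
Fact matrix_module_scaleDl v : {morph matrix_module_scale^~ v : h h' / h + h'}.
Proof. by move=> h h'; rewrite /matrix_module_scale rmorphD mulmxDl. Qed.

HB.instance Definition _ := GRing.Zmodule_isLmodule.Build H V
  matrix_module_scaleA matrix_module_scale1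
  matrix_module_scaleDr matrix_module_scaleDl.
End MatrixModule.

(* The universal DAHA of type (C_1^\vee, C_1).                                *)

Variant daha_gen := Tgen of 'I_4 | Tinv of 'I_4.

Section DAHA.
Variables (F : fieldType) (q : F).
Local Notation t i := (PGen (Tgen i) : pterm F daha_gen).
Local Notation t' i := (PGen (Tinv i) : pterm F daha_gen).

Inductive daha_rel : pterm F daha_gen -> pterm F daha_gen -> Prop :=
  | daha_mulV i : daha_rel (PMul (t i) (t' i)) (PConst 1)
  | daha_Vmul i : daha_rel (PMul (t' i) (t i)) (PConst 1)
  | daha_central i x :
      daha_rel (PMul (PAdd (t i) (t' i)) x) (PMul x (PAdd (t i) (t' i)))
  | daha_prod :
      daha_rel (PMul (PMul (PMul (t (inord 0)) (t (inord 1))) (t (inord 2)))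
                     (t (inord 3)))
               (PConst q^-1).

Definition DAHA := palg daha_rel.
HB.instance Definition _ := GRing.PzRing.on DAHA.
HB.instance Definition _ := GRing.Lmodule.on DAHA.
End DAHA.

(* E(k_0,k_1,k_2,k_3) on column vectors of size d + 1, with the standard      *)
(* basis v_0, ..., v_d. [E_t0 i], ..., [E_t3 i] are the images of v_i under   *)
(* t_0, ..., t_3, i.e. the i-th columns of the matrices [E_T]. The conditions *)
(* on the parity of i assume d odd and i <= d.                                *)

Section E_action.
Variables (F : fieldType) (q : F) (d : nat) (k0 k1 k2 k3 : F).

Definition E_v (i : nat) : 'cV[F]_d.+1 := \col_j (j == i :> nat)%:R.
Local Notation v := E_v.

Definition E_t0 (i : nat) : 'cV[F]_d.+1 :=
  if i == 0%N then k0 *: v 0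
  else if i == d then k0 *: v d
  else if odd i then (k0^-1 * q ^- i.+1) *: (v i - v i.+1)
  else (k0^-1 * q ^- i * (1 - q ^+ i) * (1 - k0 ^+ 2 * q ^+ i)) *: v i.-1
       + (k0 + k0^-1 - k0^-1 * q ^- i) *: v i.

Definition E_t1 (i : nat) : 'cV[F]_d.+1 :=
  if i == 0%N then k1 *: v 0 + k1^-1 *: v 1
  else if odd i then k1^-1 *: v i
  else (- k1 * (1 - q ^+ i) * (1 - k0 ^+ 2 * q ^+ i)) *: v i.-1
       + k1 *: v i + k1^-1 *: v i.+1.

Definition E_t2 (i : nat) : 'cV[F]_d.+1 :=
  if odd i then
    ((k0 * k1 * k3 * q ^+ i - k2) * (k0 * k1 * k3 * q ^+ i - k2^-1)
       / (k0 * k1 * k3 * q ^+ i)) *: v i.-1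
    + (k2 + k2^-1 - k0^-1 * k1^-1 * k3^-1 * q ^- i) *: v i
  else (k0^-1 * k1^-1 * k3^-1 * q ^- i.+1) *: (v i - v i.+1).

Definition E_t3 (i : nat) : 'cV[F]_d.+1 :=
  if ~~ odd i then k3 *: v i
  else if i == d then
    (- k3^-1 * (k0 * k1 * k3 * q ^+ d - k2) * (k0 * k1 * k3 * q ^+ d - k2^-1))
      *: v d.-1
    + k3^-1 *: v d
  else
    (- k3^-1 * (k0 * k1 * k3 * q ^+ i - k2) * (k0 * k1 * k3 * q ^+ i - k2^-1))
      *: v i.-1
    + k3^-1 *: v i + k3 *: v i.+1.

Definition E_T (r : 'I_4) : 'M[F]_d.+1 :=
  \matrix_(j, i) (nth E_t0 [:: E_t0; E_t1; E_t2; E_t3] r) i j 0.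

Definition E_gen (g : daha_gen) : 'M[F]_d.+1 :=
  match g with
  | Tgen r => E_T r
  | Tinv r => invmx (E_T r)
  end.

Hypothesis (q0 : q != 0) (d_odd : odd d).
Hypothesis (k0N0 : k0 != 0) (k1N0 : k1 != 0) (k2N0 : k2 != 0) (k3N0 : k3 != 0).
Hypothesis (k0q : k0 ^+ 2 = q ^- d.+1).

Lemma E_T_v r i : (i <= d)%N ->
  E_T r *m E_v i = (nth E_t0 [:: E_t0; E_t1; E_t2; E_t3] r) i.
Proof.
move=> le_id; apply/colP=> j; rewrite !mxE.
rewrite (bigD1 (Ordinal (le_id : (i < d.+1)%N))) //= !mxE eqxx mulr1.
rewrite big1 ?addr0 // => m; rewrite -val_eqE !mxE /= => /negPf->.
by rewrite mulr0.
Qed.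

Lemma mx_eq_v (A B : 'M[F]_d.+1) :
  (forall i, (i <= d)%N -> A *m E_v i = B *m E_v i) -> A = B.
Proof.
move=> AB; apply/matrixP=> a b.
have Ev (C : 'M[F]_d.+1) : C a b = (C *m E_v b) a 0.
  rewrite mxE (bigD1 b) //= mxE eqxx mulr1 big1 ?addr0 // => m.
  by rewrite mxE -val_eqE => /negPf->; rewrite mulr0.
by rewrite !Ev AB // -ltnS.
Qed.

Local Notation T r := (E_T (inord r)).

Lemma T0_0 : T 0 *m v 0 = k0 *: v 0.
Proof. by rewrite E_T_v // inordK. Qed.
Lemma T0_d : T 0 *m v d = k0 *: v d.
Proof. by rewrite E_T_v // inordK //= /E_t0 eqxx gtn_eqF ?odd_gt0. Qed.
Lemma T0_odd i : odd i -> (i < d)%N ->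
  T 0 *m v i = (k0^-1 * q ^- i.+1) *: (v i - v i.+1).
Proof.
move=> i_odd lt_id; rewrite E_T_v 1?ltnW // inordK //=.
rewrite /E_t0 i_odd (ltn_eqF lt_id).
by case: i i_odd {lt_id}.
Qed.
Lemma T0_even i : odd i -> (i < d)%N ->
  T 0 *m v i.+1 = (k0^-1 * q ^- i.+1 * (1 - q ^+ i.+1)
      * (1 - k0 ^+ 2 * q ^+ i.+1)) *: v i
    + (k0 + k0^-1 - k0^-1 * q ^- i.+1) *: v i.+1.
Proof.
move=> i_odd lt_id; rewrite E_T_v // inordK //= /E_t0 /= i_odd /=.
by have /negPf-> // : i.+1 != d; apply: contraTneq d_odd => <-; rewrite /= i_odd.
Qed.

Lemma T1_0 : T 1 *m v 0 = k1 *: v 0 + k1^-1 *: v 1.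
Proof. by rewrite E_T_v // inordK. Qed.
Lemma T1_odd i : odd i -> (i <= d)%N -> T 1 *m v i = k1^-1 *: v i.
Proof.
by move=> i_odd lt_id; rewrite E_T_v // inordK //= /E_t1 i_odd; case: i i_odd {lt_id}.
Qed.
Lemma T1_even i : odd i -> (i < d)%N ->
  T 1 *m v i.+1 = (- k1 * (1 - q ^+ i.+1) * (1 - k0 ^+ 2 * q ^+ i.+1)) *: v i
    + k1 *: v i.+1 + k1^-1 *: v i.+2.
Proof.
by move=> i_odd lt_id; rewrite E_T_v // inordK //= /E_t1 /= i_odd /=.
Qed.

Lemma T2_even i : ~~ odd i -> (i <= d)%N ->
  T 2 *m v i = (k0^-1 * k1^-1 * k3^-1 * q ^- i.+1) *: (v i - v i.+1).
Proof.
by move=> i_odd lt_id; rewrite E_T_v // inordK //= /E_t2 (negPf i_odd).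
Qed.
Lemma T2_odd i : ~~ odd i -> (i < d)%N ->
  T 2 *m v i.+1 =
    ((k0 * k1 * k3 * q ^+ i.+1 - k2) * (k0 * k1 * k3 * q ^+ i.+1 - k2^-1)
       / (k0 * k1 * k3 * q ^+ i.+1)) *: v i
    + (k2 + k2^-1 - k0^-1 * k1^-1 * k3^-1 * q ^- i.+1) *: v i.+1.
Proof.
by move=> i_odd lt_id; rewrite E_T_v // inordK //= /E_t2 /= i_odd.
Qed.

Lemma v_gt : v d.+1 = 0.
Proof. by apply/colP=> j; rewrite !mxE ltn_eqF. Qed.

Lemma T3_even i : ~~ odd i -> (i <= d)%N -> T 3 *m v i = k3 *: v i.
Proof. by move=> i_odd lt_id; rewrite E_T_v // inordK //= /E_t3 i_odd. Qed.
Lemma T3_odd i : ~~ odd i -> (i < d)%N ->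
  T 3 *m v i.+1 =
    (- k3^-1 * (k0 * k1 * k3 * q ^+ i.+1 - k2)
      * (k0 * k1 * k3 * q ^+ i.+1 - k2^-1)) *: v i
    + k3^-1 *: v i.+1 + k3 *: v i.+2.
Proof.
move=> i_odd lt_id; rewrite E_T_v // inordK //= /E_t3 /= i_odd /=.
case: eqP => // id; have -> : d.-1 = i by rewrite -id.
by rewrite id v_gt scaler0 addr0.
Qed.

Definition TE := (mulmxDr, mulmxBr, mulmxN, =^~ scalemxAr).

Ltac coords := apply/colP=> j; rewrite !mxE ?exprS ?invfM;
  repeat match goal with |- context [(nat_of_bool ?b)%:R] =>
    generalize ((nat_of_bool b)%:R : F) => ? end;
  field; rewrite ?expf_neq0 ?q0 ?k0N0 ?k1N0 ?k2N0 ?k3N0 //.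

Lemma i_cases (P : nat -> Prop) :
  P 0%N -> P d -> (forall i, odd i -> (i < d)%N -> P i /\ P i.+1) ->
  forall i, (i <= d)%N -> P i.
Proof.
move=> P0 Pd Pi [|i] //; have [i_odd /Pi[] // | i_even] := boolP (odd i).
by rewrite leq_eqVlt => /predU1P[-> // | /Pi[]].
Qed.

Lemma i_pairs (P : nat -> Prop) :
  (forall i, ~~ odd i -> (i < d)%N -> P i /\ P i.+1) ->
  forall i, (i <= d)%N -> P i.
Proof.
move=> Pi [|i le_id]; first by move=> _; case: (Pi 0%N) => //; apply: odd_gt0.
have [i_odd | i_even] := boolP (odd i); last by have [] := Pi i.
suff [] : P i.+1 /\ P i.+2 by [].
apply: Pi; rewrite /= ?i_odd // ltn_neqAle le_id andbT.
by apply: contraTneq d_odd => <-; rewrite /= i_odd.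
Qed.

Lemma E_quad r i : (i <= d)%N -> (r < 4)%N ->
  T r *m (T r *m v i) =
    let k := nth 0 [:: k0; k1; k2; k3] r in
    (k + k^-1) *: (T r *m v i) - v i.
Proof.
move=> le_id; case: r => [|[|[|[|//]]]] _; move: i le_id; cbv zeta.
- apply: i_cases => [||i io id] /=.
  + by rewrite !(T0_0, TE); coords.
  + by rewrite !(T0_d, TE); coords.
  + by rewrite !(T0_odd io id, T0_even io id, TE); split; coords.
- apply: i_cases => [||i io id] /=.
  + by rewrite !(T1_0, TE) T1_odd ?odd_gt0 //; coords.
  + by rewrite !(T1_odd, TE) //; coords.
  + have i2 : (i.+2 <= d)%N.
      by rewrite ltn_neqAle id andbT; apply: contraTneq d_odd => <-; rewrite /= io.
    rewrite !(T1_odd io (ltnW id), T1_even io id, TE).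
    have io2 : odd i.+2 by rewrite /= io.
    by rewrite (T1_odd io2) //; split; coords.
- apply: i_pairs => i io id /=.
  by rewrite !(T2_odd io id, T2_even io (ltnW id), TE); split; coords.
- apply: i_pairs => i io id /=.
  rewrite !(T3_odd io id, T3_even io (ltnW id), TE); split; first by coords.
  have [i2|] := ltnP i.+1 d; last first.
    move=> di; have -> : i.+2 = d.+1 by apply/eqP; rewrite eqSS eqn_leq id.
    by rewrite v_gt mulmx0; coords.
  have io2 : ~~ odd i.+2 by rewrite /= negbK.
  by rewrite T3_even //; coords.
Qed.

Lemma T01 i : ~~ odd i -> (i < d)%N ->
  T 0 *m (T 1 *m (v i - v i.+1)) = (k0 * k1 * q ^+ i) *: v i.
Proof.
case: i => [|i] /= io id.
  by rewrite !(T1_0, TE) T1_odd // -scalemxAr T0_0; coords.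
have {}io : odd i by rewrite -[odd i]negbK.
have io2 : odd i.+2 by rewrite /= io.
rewrite !(T1_even io (ltnW id), TE) T1_odd //.
by rewrite !(T0_odd io (ltnW id), T0_even io (ltnW id), TE); coords.
Qed.

Lemma T23_even i : ~~ odd i -> (i <= d)%N ->
  T 2 *m (T 3 *m v i) = (k0^-1 * k1^-1 * q ^- i.+1) *: (v i - v i.+1).
Proof.
by move=> io id; rewrite T3_even // -scalemxAr T2_even //; coords.
Qed.

Lemma T23_odd i : ~~ odd i -> (i < d)%N ->
  T 2 *m (T 3 *m v i.+1) = (k0 * k1 * q ^+ i.+1) *: v i.+1
    + k3 *: (T 2 *m v i.+2).
Proof.
move=> io id; rewrite T3_odd // !mulmxDr -!scalemxAr (T2_odd io id) (T2_even io (ltnW id)).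
by congr (_ + _); coords.
Qed.

Lemma E_prod : T 0 *m T 1 *m T 2 *m T 3 = (q^-1)%:M.
Proof.
apply: mx_eq_v => i le_id; rewrite mul_scalar_mx -!mulmxA; move: i le_id.
apply: i_pairs => i io id; split.
  by rewrite T23_even 1?ltnW // -!scalemxAr T01 //; coords.
rewrite T23_odd // !mulmxDr -!scalemxAr T1_odd //.
have [i2|] := ltnP i.+1 d; last first.
  move=> di; have {di} di : i.+1 = d by apply/eqP; rewrite eqn_leq id.
  rewrite di v_gt !mulmx0 scaler0 addr0 -scalemxAr T0_d !scalerA.
  congr (_ *: _); transitivity (k0 ^+ 2 * q ^+ d); first by field; rewrite k1N0.
  by rewrite k0q exprS; field; rewrite expf_neq0 ?q0.
have io2 : ~~ odd i.+2 by rewrite /= negbK.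
have i3 : (i.+2 < d)%N.
  by rewrite ltn_neqAle i2 andbT; apply: contraTneq d_odd => <-.
by rewrite T2_even // -!scalemxAr T01 // T0_odd //; coords.
Qed.

Lemma E_T_inv (r : 'I_4) :
  let k := nth 0 [:: k0; k1; k2; k3] r in
  E_T r \in unitmx /\ E_T r + invmx (E_T r) = (k + k^-1)%:M.
Proof.
move=> k; pose B := (k + k^-1)%:M - E_T r.
have TB : E_T r *m B = 1%:M.
  apply: mx_eq_v => i le_id; rewrite -mulmxA.
  have -> : B *m v i = (k + k^-1) *: v i - E_T r *m v i.
    by rewrite mulmxBl mul_scalar_mx.
  rewrite mulmxBr -scalemxAr; have := E_quad le_id (ltn_ord r); rewrite inord_val => ->.
  by rewrite subKr mul1mx.
have [Tu _] := mulmx1_unit TB; split=> //.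
have -> : invmx (E_T r) = B by rewrite -[RHS](mulKmx Tu) TB mulmx1.
by rewrite addrC subrK.
Qed.

Theorem E_rel x y : daha_rel q x y ->
  peval (A := 'M[F]_d.+1) E_gen x = peval E_gen y.
Proof.
case=> [r|r|r z|] /=.
- by have [Tu _] := E_T_inv r; rewrite scale1r; exact: mulmxV.
- by have [Tu _] := E_T_inv r; rewrite scale1r; exact: mulVmx.
- by have [_ ->] := E_T_inv r; exact: esym (scalar_mxC _ _).
- by rewrite -[1]/(1%:M) scalemx1; exact: E_prod.
Qed.

Definition E_rho : {rmorphism DAHA q -> 'M[F]_d.+1} := plift E_rel.
Definition E : lmodType (DAHA q) := matrix_module E_rho.

Lemma E_act (r : 'I_4) i : (i <= d)%N ->
  (pgen (daha_rel q) (Tgen r) : DAHA q) *: (v i : E)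
    = (nth E_t0 [:: E_t0; E_t1; E_t2; E_t3] r) i :> 'cV[F]_d.+1.
Proof.
move=> le_id; rewrite -E_T_v //.
by rewrite [LHS]/(plift E_rel _ *m v i) plift_gen.
Qed.
End E_action.

Arguments E {F} q d k0 k1 k2 k3 _ _ _ _ _ _ _.

(* Main.v *)
Require Import Defs.
From mathcomp Require Import all_boot all_order all_algebra.
From mathcomp Require Import boolp ring zify.

(** Write X = t_0 t_1, so that q t_2 t_3 is the inverse of X. In the basis v_i
    every t_r is tridiagonal, and its entry taking v_i to v_(i-1) is a multiple of
    [lowering_coef] i, by a nonzero factor for some r. This coefficient is
    (1 - q^i)(1 - k_0^2 q^i) for i even and
    (k_0 k_1 k_3 q^i - k_2)(k_0 k_1 k_3 q^i - k_2^-1) for i odd. If it vanishes,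
    then v_i, ..., v_d span a proper submodule ([lowering_coef_neq0]).

    These are only half of the obstructions; the others come from a hidden
    symmetry, E(k_0, k_1, k_2, k_3) ~ E(k_0, k_1^-1, k_2, k_3). The algebra does
    not see the difference between k_1 and k_1^-1, since t_1 has the same
    quadratic relation for both. In any module, a common eigenvector w of t_0
    and t_3 with eigenvalues k_0 and k_3 determines vectors w = w_0, w_1, ... on
    which the generators act by the formulas of E ([chain] and the lemmas on
    it). Taking w = v_0 in E(k_0, k_1, k_2, k_3), but building the chain with
    k_1^-1, gives a second basis ([chain_triangular]). The chain stops after
    w_d, because w_i is, up to a power of X, the value at X of a polynomial
    applied to w, and for i = d + 1 this polynomial is unchanged up to a scalar
    by k_1 -> k_1^-1 ([chain_poly_inv], [chain_end]). Hence the change of basis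
    matrix intertwines the two modules ([flip_unit], [flip_intertwines]), and
    the lowering coefficients for k_1^-1 must be nonzero too.

    Conversely let all of these coefficients be nonzero, and let S be a nonzero
    submodule. Lowering in the second basis, S contains a vector u whose
    coordinate on w_0 is nonzero ([stable_first_coord]). That coordinate is a
    left eigenvector of X, with the eigenvalue k_0 k_1^-1 which X also has at
    v_d. Since v_0 is cyclic for X, a power of X maps u to g(X) v_0, where
    k_0 k_1^-1 is not a root of g; and the polynomial of v_d, times
    'X - k_0 k_1^-1, annihilates v_0. So applying the polynomial of v_d to
    g(X) v_0 leaves a nonzero multiple of v_d, and v_d is in S. Lowering in the
    first basis, S contains every v_i ([stable_last_full],
    [irreducible_action_E]).

    It remains to translate the nonvanishing of the coefficients for k_1 and
    k_1^-1 into conditions (i)-(iii), where k_0^2 = q^(-d-1) exchanges the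
    exponents i and d + 1 - i ([reflect_coef]). *)

Set Implicit Arguments.
Unset Strict Implicit.
Unset Printing Implicit Defensive.

Import GRing.Theory.
Local Open Scope ring_scope.

(** * Chains of vectors generated by a common eigenvector of t_0 and t_3 *)

Section QuadraticOperator.
Variables (F : fieldType) (n : nat) (k : F) (T : 'M[F]_n).
Implicit Types x y z : 'cV[F]_n.
Hypothesis k_neq0 : k != 0.
Hypothesis quadT : T *m T = (k + k^-1) *: T - 1%:M.

Lemma quad_apply x : T *m (T *m x) = (k + k^-1) *: (T *m x) - x.
Proof. by rewrite mulmxA quadT mulmxBl -scalemxAl mul1mx. Qed.

Lemma quad_injective x y : T *m x = T *m y -> x = y.
Proof.
move=> Txy; have := quad_apply x; rewrite Txy quad_apply.
by move/addrI/oppr_inj.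
Qed.

Lemma quad_inv x y : T *m x = y -> x = (k + k^-1) *: y - T *m y.
Proof. by move=> <-; rewrite quad_apply opprB addrC subrK. Qed.

(** When T moves y to a combination of y and z, the quadratic relation leaves no
    choice for T z. This gives the action of t_0 on even members of a chain and
    of t_2 on odd ones. *)
Lemma quad_next c y z : c != 0 -> T *m y = c *: (y - z) ->
  T *m z = (c - (k + k^-1) + c^-1) *: y + (k + k^-1 - c) *: z.
Proof.
move=> c0 Ty; have := quad_apply y; rewrite Ty -scalemxAr mulmxBr Ty => E.
have -> : T *m z = c *: (y - z) - c^-1 *: (c *: (c *: (y - z) - T *m z)).
  by rewrite scalerA mulVf // scale1r opprB addrC subrK.
by rewrite E; apply/colP=> j; rewrite !mxE; field; rewrite c0 k_neq0.
Qed.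

(** Applying T to T (y - z) gives T x + k^-1 T y, whose first term is known, while
    the quadratic relation gives the sum; so T y is found, and T z by difference.
    This is the step by which t_1 and t_3 are computed along a chain. *)
Lemma quad_split x y z : T *m x = k *: x -> T *m (y - z) = x + k^-1 *: y ->
  T *m y = x + k^-1 *: y + k *: z /\ T *m z = k *: z.
Proof.
move=> Tx Tyz; have := quad_apply (y - z).
rewrite Tyz mulmxDr Tx -scalemxAr => E.
have Ty : T *m y = x + k^-1 *: y + k *: z.
  have -> : T *m y = k *: (k *: x + k^-1 *: (T *m y)) - k *: (k *: x).
    by rewrite scalerDr [k *: (k^-1 *: _)]scalerA divff // scale1r addrC addKr.
  by rewrite E; apply/colP=> j; rewrite !mxE; field; rewrite k_neq0.
split=> //; have -> : T *m z = T *m y - T *m (y - z).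
  by rewrite mulmxBr subKr.
by rewrite Ty Tyz addrC addKr.
Qed.
End QuadraticOperator.

(** The coefficients of v_(i-1) in the image of v_i, up to nonzero factors: under
    t_0 and t_1 for i even, under t_2 and t_3 for i odd. *)
Definition even_coef (F : fieldType) (q k0 : F) (i : nat) : F :=
  (1 - q ^+ i) * (1 - k0 ^+ 2 * q ^+ i).

Definition odd_coef (F : fieldType) (q k0 k1 k2 k3 : F) (i : nat) : F :=
  (k0 * k1 * k3 * q ^+ i - k2) * (k0 * k1 * k3 * q ^+ i - k2^-1).

Section Universal.
Variables (F : fieldType) (n : nat) (q k0 k1 k2 k3 : F).
Variables T0 T1 T2 T3 : 'M[F]_n.+1.

(** The recursion solves for v_(i+1) the formulas that express t_2 v_i, for i
    even, and t_0 v_i, for i odd, through v_i and v_(i+1). *)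
Fixpoint chain (w : 'cV[F]_n.+1) (i : nat) : 'cV[F]_n.+1 :=
  if i is j.+1 then
    if odd j then chain w j - (k0 * q ^+ j.+1) *: (T0 *m chain w j)
    else chain w j - (k0 * k1 * k3 * q ^+ j.+1) *: (T2 *m chain w j)
  else w.

(** The i-th member of the chain of w is this polynomial in T0 T1 applied to w,
    up to the power of T0 T1 that clears inverses; see [chain_horner]. *)
Fixpoint chain_poly (i : nat) : {poly F} :=
  if i is j.+1 then
    if odd j then chain_poly j * (1 - (k0 * k1 * q ^+ j.+1) *: 'X)
    else chain_poly j * ('X - (k0 * k1 * q ^+ j)%:P)
  else 1.

Hypotheses (q_neq0 : q != 0) (k0_neq0 : k0 != 0) (k1_neq0 : k1 != 0).
Hypotheses (k2_neq0 : k2 != 0) (k3_neq0 : k3 != 0).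
Hypothesis quad0 : T0 *m T0 = (k0 + k0^-1) *: T0 - 1%:M.
Hypothesis quad1 : T1 *m T1 = (k1 + k1^-1) *: T1 - 1%:M.
Hypothesis quad2 : T2 *m T2 = (k2 + k2^-1) *: T2 - 1%:M.
Hypothesis quad3 : T3 *m T3 = (k3 + k3^-1) *: T3 - 1%:M.
Hypothesis prodT : T0 *m T1 *m T2 *m T3 = (q^-1)%:M.

Variable w : 'cV[F]_n.+1.
Hypotheses (T0w : T0 *m w = k0 *: w) (T3w : T3 *m w = k3 *: w).
Local Notation w_ := (chain w).

Let qX_neq0 m : q ^+ m != 0. Proof. exact: expf_neq0. Qed.
Ltac nz := rewrite ?k0_neq0 ?k1_neq0 ?k2_neq0 ?k3_neq0 ?q_neq0 ?qX_neq0 ?oner_neq0 //.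
Let prod_apply (x : 'cV_n.+1) : T0 *m (T1 *m (T2 *m (T3 *m x))) = q^-1 *: x.
Proof. by rewrite !mulmxA prodT mul_scalar_mx. Qed.

Lemma chain_T0_odd i : odd i ->
  T0 *m w_ i = (k0^-1 * q ^- i.+1) *: (w_ i - w_ i.+1).
Proof.
move=> io; rewrite /= io subKr scalerA mulrACA mulVf // mul1r mulVf //.
by rewrite scale1r.
Qed.

Lemma chain_T2_even i : ~~ odd i ->
  T2 *m w_ i = (k0^-1 * k1^-1 * k3^-1 * q ^- i.+1) *: (w_ i - w_ i.+1).
Proof.
move=> /negPf io; rewrite /= io subKr scalerA -[LHS]scale1r; congr (_ *: _).
by field; nz.
Qed.

Local Notation phi := (odd_coef q k0 k1 k2 k3).

Lemma chain_T2_odd i : ~~ odd i ->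
  T2 *m w_ i.+1 = (phi i.+1 / (k0 * k1 * k3 * q ^+ i.+1)) *: w_ i
    + (k2 + k2^-1 - k0^-1 * k1^-1 * k3^-1 * q ^- i.+1) *: w_ i.+1.
Proof.
move=> io; rewrite (quad_next k2_neq0 quad2 _ (chain_T2_even io)); last first.
  by rewrite !mulf_neq0 ?invr_eq0 ?qX_neq0.
congr (_ *: _ + _); rewrite /odd_coef.
by field; nz.
Qed.

Local Notation lo := (even_coef q k0).

(** The inductive step, from an even index to the next one. The product relation
    gives T1 on w_i - w_(i+1), and then T3 on w_(i+1) - w_(i+2), so
    [quad_split] yields T1 and T3 on each of these vectors. The hypotheses and
    conclusions on w_(i-1) carry the factor [even_coef], which vanishes at i = 0
    where w_(i-1) has no meaning. *)
Let even_step i : ~~ odd i ->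
  T3 *m w_ i = k3 *: w_ i ->
  T0 *m w_ i = (k0^-1 * q ^- i * lo i) *: w_ i.-1 + (k0 + k0^-1 - k0^-1 * q ^- i) *: w_ i ->
  T1 *m (lo i *: w_ i.-1) = k1^-1 *: (lo i *: w_ i.-1) ->
  [/\ T1 *m w_ i = (- k1 * lo i) *: w_ i.-1 + k1 *: w_ i + k1^-1 *: w_ i.+1,
      T1 *m w_ i.+1 = k1^-1 *: w_ i.+1
    & [/\ T3 *m w_ i.+1 = (- k3^-1 * phi i.+1) *: w_ i + k3^-1 *: w_ i.+1
                          + k3 *: w_ i.+2,
          T3 *m w_ i.+2 = k3 *: w_ i.+2
        & T0 *m w_ i.+2 = (k0^-1 * q ^- i.+2 * lo i.+2) *: w_ i.+1
                          + (k0 + k0^-1 - k0^-1 * q ^- i.+2) *: w_ i.+2]].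
Proof.
move=> io T3i T0i T1p.
have T1d : T1 *m (w_ i - w_ i.+1) = (- k1 * lo i) *: w_ i.-1 + k1 *: w_ i.
  have := prod_apply (w_ i); rewrite T3i -!scalemxAr chain_T2_even // -!scalemxAr.
  rewrite scalerA => /(congr1 (fun x => (k0 * k1 * q ^+ i.+1) *: x)).
  rewrite !scalerA (_ : _ * (k3 * _) = 1); last first.
    by field; nz.
  rewrite scale1r => T01; have {T01} := quad_inv quad0 T01 => ->.
  rewrite -scalemxAr T0i; apply/colP=> j; rewrite !mxE.
move: (w_ i j 0) (w_ i.-1 j 0) (lo i) => a b c; rewrite exprS.
  by field; nz.
have k1V : k1^-1 != 0 by rewrite invr_eq0.
have quad1' : T1 *m T1 = (k1^-1 + k1^-1^-1) *: T1 - 1%:M.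
  by rewrite invrK [_ + k1]addrC.
have T1l : T1 *m ((- k1 * lo i) *: w_ i.-1) = k1^-1 *: ((- k1 * lo i) *: w_ i.-1).
  by rewrite -[_ *: w_ _]scalerA -[LHS]scalemxAr T1p !scalerA; congr (_ *: _); ring.
have T1d' : T1 *m (w_ i - w_ i.+1)
    = (- k1 * lo i) *: w_ i.-1 + k1^-1^-1 *: w_ i by rewrite invrK.
have [T1i T1n] := quad_split k1V quad1' T1l T1d'; rewrite invrK in T1i.
have io1 : odd i.+1 by rewrite /= io.
have T3d : T3 *m (w_ i.+1 - w_ i.+2)
    = (- k3^-1 * phi i.+1) *: w_ i + k3^-1 *: w_ i.+1.
  have T23 : T2 *m (T3 *m (w_ i.+1 - w_ i.+2)) = (k0 * k1 * q ^+ i.+1) *: w_ i.+1.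
    apply: (quad_injective quad1); apply: (quad_injective quad0).
    rewrite prod_apply -!scalemxAr T1n -scalemxAr chain_T0_odd // !scalerA.
    congr (_ *: _); rewrite !exprS; field; nz.
  have {T23} -> := quad_inv quad2 T23.
  rewrite -scalemxAr chain_T2_odd //; apply/colP=> j; rewrite !mxE.
  field; nz.
have T3l : T3 *m ((- k3^-1 * phi i.+1) *: w_ i) = k3 *: ((- k3^-1 * phi i.+1) *: w_ i).
  by rewrite -scalemxAr T3i !scalerA mulrC.
have [T3n T3nn] := quad_split k3_neq0 quad3 T3l T3d.
split=> //; split=> //.
have c0 : k0^-1 * q ^- i.+2 != 0 by rewrite mulf_neq0 ?invr_eq0.
rewrite (quad_next k0_neq0 quad0 c0 (chain_T0_odd io1)).
congr (_ *: _ + _); rewrite /even_coef !exprS; field; nz.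
Qed.

Lemma chain_facts i : ~~ odd i ->
  [/\ T3 *m w_ i = k3 *: w_ i,
      T0 *m w_ i = (k0^-1 * q ^- i * lo i) *: w_ i.-1
                   + (k0 + k0^-1 - k0^-1 * q ^- i) *: w_ i
    & T1 *m (lo i *: w_ i.-1) = k1^-1 *: (lo i *: w_ i.-1)].
Proof.
move=> /negPf io; rewrite -[i]odd_double_half io add0n; elim: i./2 => [|j IHj].
  rewrite /even_coef expr0 subrr mul0r !mulr0 !scale0r mulmx0 scaler0 add0r.
  by rewrite T0w; split=> //; congr (_ *: _); rewrite invr1; ring.
have jo : ~~ odd j.*2 by rewrite odd_double.
have [T3j T0j T1j] := IHj; have [_ T1n [_ T3n T0n]] := even_step jo T3j T0j T1j.
by split=> //; rewrite -scalemxAr T1n scalerA mulrC -scalerA.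
Qed.

Lemma chain_T3_even i : ~~ odd i -> T3 *m w_ i = k3 *: w_ i.
Proof. by case/chain_facts. Qed.

Lemma chain_T0_even i : ~~ odd i ->
  T0 *m w_ i = (k0^-1 * q ^- i * lo i) *: w_ i.-1
               + (k0 + k0^-1 - k0^-1 * q ^- i) *: w_ i.
Proof. by case/chain_facts. Qed.

Lemma chain_T1_even i : ~~ odd i ->
  T1 *m w_ i = (- k1 * lo i) *: w_ i.-1 + k1 *: w_ i + k1^-1 *: w_ i.+1.
Proof. by move=> io; case: (chain_facts io) => T3i T0i /(even_step io T3i T0i)[]. Qed.

Lemma chain_T1_odd i : ~~ odd i -> T1 *m w_ i.+1 = k1^-1 *: w_ i.+1.
Proof. by move=> io; case: (chain_facts io) => T3i T0i /(even_step io T3i T0i)[]. Qed.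

Lemma chain_T3_odd i : ~~ odd i ->
  T3 *m w_ i.+1 = (- k3^-1 * phi i.+1) *: w_ i + k3^-1 *: w_ i.+1 + k3 *: w_ i.+2.
Proof.
by move=> io; case: (chain_facts io) => T3i T0i /(even_step io T3i T0i)[_ _ []].
Qed.

(** With X = T0 T1, one step of the chain multiplies by 1 - k0 k1 q^i X^-1 from
    an even index and by 1 - k0 k1 q^(i+1) X from an odd one. *)
Lemma chain_X_even i : ~~ odd i ->
  T0 *m T1 *m w_ i.+1 = T0 *m T1 *m w_ i - (k0 * k1 * q ^+ i) *: w_ i.
Proof.
move=> io; have := prod_apply (w_ i).
rewrite chain_T3_even // -!scalemxAr chain_T2_even // -!scalemxAr !mulmxBr.
move/(congr1 (fun x => (k0 * k1 * q ^+ i.+1) *: x)).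
rewrite !scalerA (_ : _ * (k3 * _) = 1) ?scale1r; last by field; nz.
rewrite !mulmxA => T01; rewrite -[LHS](subKr (T0 *m T1 *m w_ i)) T01.
by congr (_ - _ *: _); rewrite exprS; field; nz.
Qed.

Lemma chain_X_odd i : odd i ->
  w_ i.+1 = w_ i - (k0 * k1 * q ^+ i.+1) *: (T0 *m T1 *m w_ i).
Proof.
case: i => // i /= io; rewrite io -mulmxA chain_T1_odd //.
rewrite -scalemxAr scalerA; congr (_ - _ *: _).
by field; nz.
Qed.

Lemma chain_horner i :
  (T0 *m T1) ^+ uphalf i *m w_ i = horner_mx (T0 *m T1) (chain_poly i) *m w.
Proof.
set X := T0 *m T1; elim: i => [|i IHi]; first by rewrite rmorph1.
have [io | io] := boolP (odd i).
  have -> : uphalf i.+1 = uphalf i by rewrite [RHS]uphalf_half io.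
  rewrite chain_X_odd // mulmxBr -scalemxAr -/X mulmxA.
  rewrite [_ *m X](_ : _ = X *m X ^+ uphalf i); last by rewrite mulmxE -exprSr exprS.
  rewrite -mulmxA IHi /= io [_ * (1 - _)]mulrC rmorphM rmorphB rmorph1 /= horner_mxZ horner_mx_X.
  by rewrite -mulmxE mulmxA mulmxBl mul1mx -scalemxAl mulmxBl -scalemxAl.
have -> : uphalf i.+1 = (uphalf i).+1 by rewrite [in RHS]uphalf_half (negPf io).
rewrite exprSr -mulmxE -mulmxA chain_X_even // -/X mulmxBr -scalemxAr mulmxA.
rewrite [_ *m X](_ : _ = X *m X ^+ uphalf i); last by rewrite mulmxE -exprSr exprS.
rewrite -mulmxA IHi /= (negPf io) [_ * (_ - _)]mulrC rmorphM rmorphB /= horner_mx_X horner_mx_C.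
by rewrite -mulmxE mulmxBl mulmxBl mul_scalar_mx -scalemxAl mulmxA.
Qed.
End Universal.

(** * The polynomials of a chain under inversion of k_1 *)

Lemma chain_poly_double (F : fieldType) (q k0 k1 : F) (n : nat) :
  chain_poly q k0 k1 n.*2 =
    \prod_(m < n) (('X - (k0 * k1 * q ^+ m.*2)%:P)
                   * (1 - (k0 * k1 * q ^+ m.*2.+2) *: 'X)).
Proof.
elim: n => [|n IHn]; first by rewrite big_ord0.
by rewrite doubleS /= odd_double /= IHn big_ord_recr /= mulrA.
Qed.

(** The hypothesis on k0 makes the roots of the factors of even and odd rank the
    numbers k0 k1 q^(2m) and k0 k1^-1 q^(2m), for 0 <= m < n, so that replacing
    k1 by its inverse exchanges the two families. *)
Lemma chain_poly_inv (F : fieldType) (q k0 k1 : F) (n : nat) :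
  q != 0 -> k0 != 0 -> k1 != 0 -> k0 ^+ 2 = q ^- n.*2 ->
  exists c, chain_poly q k0 k1^-1 n.*2 = c *: chain_poly q k0 k1 n.*2.
Proof.
move=> q0 k00 k10 k0q.
have nz e : k0 * k1^-1 * q ^+ e != 0.
  by rewrite mulf_neq0 ?expf_neq0 // mulf_neq0 ?invr_eq0.
pose c m := (k0 * k1^-1 * q ^+ m.*2) * (k0 * k1^-1 * q ^+ m.*2.+2).
exists (\prod_(m < n) c m); rewrite !chain_poly_double.
rewrite [X in _ = _ *: X](reindex_inj rev_ord_inj) /= -scaler_prod.
apply: eq_bigr => m _; rewrite /c.
have opposite e : (e <= n)%N ->
    k0 * k1 * q ^+ (n - e).*2 = (k0 * k1^-1 * q ^+ e.*2)^-1.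
  move=> en; apply: (mulIf (nz e.*2)); rewrite mulVf //.
  transitivity (k0 ^+ 2 * (q ^+ (n - e).*2 * q ^+ e.*2)); first by field.
  by rewrite -exprD -doubleD subnK // k0q mulVf // expf_neq0.
have flip (x : F) : x != 0 -> 1 - x *: 'X = - x *: ('X - x^-1%:P) :> {poly F}.
  move=> x0; rewrite scalerBr !scaleNr opprK -!mul_polyC -polyCM divff //.
  by rewrite addrC.
have -> : (n - m.+1).*2.+2 = (n - m).*2 by rewrite subnS -doubleS prednK ?subn_gt0.
rewrite opposite // (opposite m) 1?ltnW // doubleS !flip ?invr_eq0 // invrK.
rewrite -!scalerAr scalerA; congr (_ *: _); last exact: mulrC.
move: (_ * q ^+ m.*2) (nz m.*2) (_ * _) => a a0 b; by field.
Qed.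

(** * Submodules as stable subsets of column vectors *)

(** The subsets of column vectors that a submodule of E may be, without
    reference to the algebra: the generators suffice, as the inverse of each t_r
    is a combination of t_r and the identity. *)
Definition stable (F : fieldType) n (T : 'I_4 -> 'M[F]_n) (S : {pred 'cV[F]_n}) :=
  [/\ 0 \in S, forall a, {in S &, forall x y, a *: x + y \in S}
    & forall r, {in S, forall x, T r *m x \in S}].

Definition irreducible_action (F : fieldType) n (T : 'I_4 -> 'M[F]_n) :=
  forall S, stable T S -> {in S, forall x, x = 0} \/ forall x, x \in S.

Section StableSubspace.
Variables (F : fieldType) (n : nat) (T : 'I_4 -> 'M[F]_n) (S : {pred 'cV[F]_n}).
Hypothesis stS : stable T S.

Lemma stableD : {in S &, forall x y, x + y \in S}.
Proof. by case: stS => _ lin _ x y xS yS; rewrite -[x]scale1r lin. Qed.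

Lemma stableZ a : {in S, forall x, a *: x \in S}.
Proof. by case: stS => S0 lin _ x xS; rewrite -[_ *: _]addr0 lin. Qed.

Lemma stableB : {in S &, forall x y, x - y \in S}.
Proof. by move=> x y xS yS; rewrite -scaleN1r stableD ?stableZ. Qed.

Lemma stableT r : {in S, forall x, T r *m x \in S}.
Proof. by case: stS. Qed.
End StableSubspace.

Lemma stable_horner (F : fieldType) n (T : 'I_4 -> 'M[F]_n.+1) S (X : 'M[F]_n.+1) g :
  stable T S -> {in S, forall x, X *m x \in S} ->
  {in S, forall x, horner_mx X g *m x \in S}.
Proof.
move=> stS SX; elim/poly_ind: g => [|g c IHg] x xS.
  by rewrite rmorph0 mul0mx; case: stS.
rewrite rmorphD rmorphM /= horner_mx_X horner_mx_C mulmxDl mul_scalar_mx.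
by rewrite (stableD stS) ?(stableZ stS) // -mulmxE -mulmxA IHg ?SX.
Qed.

Lemma horner_left_eigen (F : fieldType) n (X : 'M[F]_n.+1) (f : 'rV_n.+1) a g :
  f *m X = a *: f -> f *m horner_mx X g = g.[a] *: f.
Proof.
move=> fX; elim/poly_ind: g => [|g c IHg].
  by rewrite rmorph0 mulmx0 horner0 scale0r.
rewrite rmorphD rmorphM /= horner_mx_X horner_mx_C mulmxDr -mulmxE mulmxA IHg.
by rewrite -scalemxAl fX mul_mx_scalar !hornerE scalerDl scalerA.
Qed.

(** Both the scalars and the generators of the algebra act through elements of
    the presentation, and induction on a formal expression recovers the whole
    action from them. *)
Lemma irreducible_moduleE (F : fieldType) (q : F) (d : nat) (k0 k1 k2 k3 : F)
    (q0 : q != 0) (d_odd : odd d) (k00 : k0 != 0) (k10 : k1 != 0)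
    (k20 : k2 != 0) (k30 : k3 != 0) (k0q : k0 ^+ 2 = q ^- d.+1) :
  irreducible_module (E q d k0 k1 k2 k3 q0 d_odd k00 k10 k20 k30 k0q)
    <-> irreducible_action (E_T q d k0 k1 k2 k3).
Proof.
set V := E _ _ _ _ _ _ _ _ _ _ _ _ _.
have actE (x : pterm F daha_gen) (v : 'cV[F]_d.+1) :
    (pclass (daha_rel q) x : DAHA q) *: (v : V)
      = peval (A := 'M[F]_d.+1) (E_gen q d k0 k1 k2 k3) x *m v.
  by rewrite [LHS]/(plift _ _ *m v) plift_class.
split=> [[_ irrE] S stS | irrT].
  apply: (irrE S); split=> [|h x y xS yS]; first by case: stS.
  apply: (stableD stS) => //; elim/pclassW: h => t; rewrite actE.
  elim: t x xS {y yS} => [[r|r]|c|t IHt|t1 IH1 t2 IH2|t1 IH1 t2 IH2] x xS /=.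
  - exact: (stableT stS).
  - have [_] := E_T_inv q0 d_odd k00 k10 k20 k30 r.
    set s := nth _ _ _ => /(canRL (addKr _)) ->.
    rewrite mulmxDl mulNmx mul_scalar_mx addrC.
    by rewrite (stableB stS) ?(stableZ stS) ?(stableT stS).
  - by rewrite -scalemxAl mul1mx (stableZ stS).
  - by rewrite mulNmx -scaleN1r (stableZ stS) ?IHt.
  - by rewrite mulmxDl (stableD stS) ?IH1 ?IH2.
  - by rewrite -mulmxE -mulmxA IH1 ?IH2.
split.
  exists (E_v F d 0); apply/eqP => /matrixP/(_ 0 0)/eqP.
  by rewrite !mxE oner_eq0.
move=> S [S0 linS]; apply: irrT; split=> // [a x y xS yS|r x xS].
  have := linS (pclass (daha_rel q) (PConst a)) x y xS yS.
  by rewrite actE /= -scalemxAl mul1mx.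
by have := linS (pclass (daha_rel q) (PGen (Tgen r))) x 0 xS S0; rewrite actE addr0.
Qed.

(** * Coordinates: tridiagonality and lowering *)

Section Matrices.
Variables (F : fieldType) (q : F) (d : nat) (k0 k1 k2 k3 : F).
Local Notation v := (E_v F d).
Local Notation T := (E_T q d k0 k1 k2 k3).
Local Notation T_ r := (E_T q d k0 k1 k2 k3 (inord r)).

Definition lowering_coef (i : nat) : F :=
  if odd i then odd_coef q k0 k1 k2 k3 i else even_coef q k0 i.

Ltac kill_index := repeat match goal with |- context [@eq_op _ ?a ?b] =>
  have -> : (a == b) = false by apply/eqP; lia end.

Lemma E_T_tridiagonal r (j m : 'I_d.+1) :
  (m.+1 < j)%N || (j.+1 < m)%N -> T r j m = 0.
Proof.
have := ltn_ord j; have := ltn_ord m => md jd far; rewrite mxE.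
by case: r => [[|[|[|[|//]]]] lt4] /=; rewrite /E_t0 /E_t1 /E_t2 /E_t3;
  do ?[case: ifP => ?]; rewrite !mxE; kill_index; rewrite /= ?(mulr0, subr0, addr0).
Qed.

Lemma E_T_mul_lower r (j i : 'I_d.+1) (u : 'cV[F]_d.+1) :
  i = j.+1 :> nat -> (forall a : 'I_d.+1, (a < i)%N -> u a 0 = 0) ->
  (T r *m u) j 0 = T r j i * u i 0.
Proof.
move=> ij u0; rewrite mxE (bigD1 i) //= big1 ?addr0 // => a ai.
have [/u0-> | ia] := ltnP a i; first by rewrite mulr0.
rewrite E_T_tridiagonal ?mul0r //; apply/orP; right.
by rewrite -ij ltn_neqAle ia andbT eq_sym.
Qed.

Lemma E_T_mul_raise r (j i : 'I_d.+1) (u : 'cV[F]_d.+1) :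
  j = i.+1 :> nat -> (forall a : 'I_d.+1, (i < a)%N -> u a 0 = 0) ->
  (T r *m u) j 0 = T r j i * u i 0.
Proof.
move=> ij u0; rewrite mxE (bigD1 i) //= big1 ?addr0 // => a ai.
have [/u0-> | ia] := ltnP i a; first by rewrite mulr0.
rewrite E_T_tridiagonal ?mul0r //; apply/orP; left.
by rewrite ij ltnS ltn_neqAle ia andbT.
Qed.

Lemma E_T_mul_far r (j : 'I_d.+1) (i : nat) (u : 'cV[F]_d.+1) :
  (i.+1 < j)%N -> (forall a : 'I_d.+1, (i < a)%N -> u a 0 = 0) ->
  (T r *m u) j 0 = 0.
Proof.
move=> ij u0; rewrite mxE big1 // => a _.
have [/u0-> | ia] := ltnP i a; first by rewrite mulr0.
by rewrite E_T_tridiagonal ?mul0r //; apply/orP; left; apply: leq_ltn_trans ij.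
Qed.

Lemma E_v_sum (x : 'cV[F]_d.+1) : x = \sum_(i < d.+1) x i 0 *: v i.
Proof.
apply/colP=> j; rewrite summxE (bigD1 j) //= !mxE eqxx mulr1 big1 ?addr0 //.
by move=> i ij; rewrite !mxE val_eqE eq_sym (negPf ij) mulr0.
Qed.

Lemma E_first_row0 :
  delta_mx 0 0 *m T_ 0 = k0 *: delta_mx 0 0 :> 'rV[F]_d.+1.
Proof.
apply/rowP=> j; rewrite -rowE !mxE inordK //= /E_t0 -val_eqE /=.
have [j0|j0] := eqVneq (j : nat) 0%N; first by rewrite !mxE.
have := ltn_ord j; rewrite mulr0 => jd; case: ifP => [/eqP jE|_]; last case: ifP => jo;
  by rewrite !mxE -[nat_of_ord 0]/0%N; kill_index; rewrite ?(mulr0, subr0, addr0).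
Qed.

Lemma E_first_row1 :
  delta_mx 0 0 *m T_ 1 = k1 *: delta_mx 0 0 :> 'rV[F]_d.+1.
Proof.
apply/rowP=> j; rewrite -rowE !mxE inordK //= /E_t1 -val_eqE /=.
have [j0|j0] := eqVneq (j : nat) 0%N; first by rewrite !mxE /= !mulr1 mulr0 addr0.
have := ltn_ord j; rewrite mulr0 => jd; case: ifP => jo;
  by rewrite !mxE -[nat_of_ord 0]/0%N; kill_index; rewrite ?(mulr0, subr0, addr0).
Qed.

Lemma E_T_lower0 r (j i : 'I_d.+1) :
  i = j.+1 :> nat -> lowering_coef i = 0 -> T r j i = 0.
Proof.
have := ltn_ord j; have := ltn_ord i; rewrite /lowering_coef /odd_coef /even_coef mxE.
case: r => [[|[|[|[|//]]]] lt4] /= id jd ij; rewrite /E_t0 /E_t1 /E_t2 /E_t3;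
  have [io|io] := boolP (odd i) => /= c0; do ?[case: ifP => ?];
  rewrite !mxE; rewrite -?[_ * _ * (1 - _)]mulrA -?[_ * _ * (_ - k2^-1)]mulrA ?c0;
  rewrite ?(mulr0, mul0r, add0r); kill_index; rewrite /= ?(mulr0, subr0, addr0) //.
have {}id : i = d :> nat by apply/eqP.
by rewrite id in c0; rewrite c0 mulr0 mul0r.
Qed.

Hypotheses (q_neq0 : q != 0) (d_odd : odd d).
Hypotheses (k0_neq0 : k0 != 0) (k1_neq0 : k1 != 0).
Hypotheses (k2_neq0 : k2 != 0) (k3_neq0 : k3 != 0).

Lemma E_quad_mx r : (r < 4)%N ->
  let k := nth 0 [:: k0; k1; k2; k3] r in
  T_ r *m T_ r = (k + k^-1) *: T_ r - 1%:M.
Proof.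
move=> r4 k; apply: mx_eq_v => i id; rewrite -mulmxA E_quad //.
by rewrite mulmxBl -scalemxAl mul1mx.
Qed.

Lemma E_lower i : (i < d)%N -> lowering_coef i.+1 != 0 ->
  exists r, exists2 c, c != 0 & exists b,
    T r *m v i.+1 = c *: v i + b *: v i.+1.
Proof.
move=> id; rewrite /lowering_coef /odd_coef /even_coef /=.
have [io|io] /= := boolP (odd i) => c0.
  exists (inord 0); rewrite T0_even //; eexists; last by eexists.
  by rewrite -mulrA mulf_neq0 // mulf_neq0 ?invr_eq0 ?expf_neq0.
exists (inord 2); rewrite T2_odd //; eexists; last by eexists.
by rewrite mulf_neq0 // invr_eq0 mulf_neq0 ?expf_neq0 // !mulf_neq0.
Qed.

Lemma stable_lower S i : stable T S -> (i < d)%N -> lowering_coef i.+1 != 0 ->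
  v i.+1 \in S -> v i \in S.
Proof.
move=> stS id c0 vS; have [r [c cN0 [b Tv]]] := E_lower id c0.
have -> : v i = c^-1 *: (T r *m v i.+1 - b *: v i.+1).
  by rewrite Tv addrK scalerA mulVf // scale1r.
by rewrite (stableZ stS) ?(stableB stS) ?(stableT stS) ?(stableZ stS).
Qed.

Hypothesis lowering_neq0 : forall i, (0 < i <= d)%N -> lowering_coef i != 0.

Lemma stable_last_full S : stable T S -> v d \in S -> forall x, x \in S.
Proof.
move=> stS vd x.
have vS i : (i <= d)%N -> v (d - i) \in S.
  elim: i => [|i IHi] id; first by rewrite subn0.
  apply: (stable_lower stS); first by lia.
    by apply: lowering_neq0; lia.
  by rewrite -subSn // subSS IHi // ltnW.
rewrite [x]E_v_sum.
elim/big_ind: _ => [|y z|i _]; [by case: stS | exact: (stableD stS) |].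
by rewrite (stableZ stS) // -[val i](subKn (ltn_ord i : (i <= d)%N)) vS // leq_subr.
Qed.

(** While the first nonzero coordinate of a vector has positive index, one of the
    generators moves it to the index below. *)
Lemma stable_first_coord S x : stable T S -> x \in S -> x != 0 ->
  exists2 u, u \in S & u 0 0 != 0.
Proof.
move=> stS xS x0.
have [j xj] : exists j, x j 0 != 0.
  apply/existsP; apply: contraNT x0 => /existsPn x0; apply/eqP/colP=> j.
  by rewrite mxE; apply/eqP; rewrite -[_ == _]negbK x0.
have [m] := ubnP (nat_of_ord j); elim: m => // m IHm in x xS {x0} j xj *.
rewrite ltnS => jm.
have [/existsP[a /andP[aj xa]] | /existsPn x_lt] :=
  boolP [exists a : 'I_d.+1, (a < j)%N && (x a 0 != 0)].
  by apply: (IHm x xS a xa); apply: leq_trans jm.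
have {}x_lt (a : 'I_d.+1) : (a < j)%N -> x a 0 = 0.
  by move=> aj; apply/eqP; have := x_lt a; rewrite aj negbK.
case: j xj jm x_lt => [[|j] jd] xj jm x_lt.
  by exists x => //; rewrite (_ : 0 = Ordinal jd) //; apply: val_inj.
have jd' : (j < d.+1)%N by apply: ltnW.
have [r [c c0 [b Tv]]] := E_lower (jd : (j < d)%N) (lowering_neq0 (jd : (0 < j.+1 <= d)%N)).
apply: (IHm (T r *m x) _ (Ordinal jd')) => //; first exact: (stableT stS).
rewrite (E_T_mul_lower r (i := Ordinal jd)) // mulf_neq0 //.
have := E_T_mul_lower r (j := Ordinal jd') (i := Ordinal jd) (u := v j.+1) erefl.
rewrite Tv !mxE /= eqxx (ltn_eqF (ltnSn j)) mulr1 mulr0 addr0 eqxx mulr1 => <- // a aj.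
by rewrite mxE ltn_eqF.
Qed.
End Matrices.

(** * The isomorphism exchanging k_1 and its inverse *)

Section Flip.
Variables (F : fieldType) (q : F) (d : nat) (k0 k1 k2 k3 : F).
Hypotheses (q_neq0 : q != 0) (d_odd : odd d).
Hypotheses (k0_neq0 : k0 != 0) (k1_neq0 : k1 != 0).
Hypotheses (k2_neq0 : k2 != 0) (k3_neq0 : k3 != 0).
Hypothesis k0q : k0 ^+ 2 = q ^- d.+1.
Local Notation v := (E_v F d).
Local Notation T := (E_T q d k0 k1 k2 k3).
Local Notation T_ r := (E_T q d k0 k1 k2 k3 (inord r)).
Local Notation X := (T_ 0 *m T_ 1).
Local Notation T' := (E_T q d k0 k1^-1 k2 k3).
Local Notation w := (chain q k0 k1^-1 k3 (T_ 0) (T_ 2) (v 0)).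

Let k1V_neq0 : k1^-1 != 0. Proof. by rewrite invr_eq0. Qed.
Let quad0 := E_quad_mx q_neq0 d_odd k0_neq0 k1_neq0 k2_neq0 k3_neq0 (r := 0) isT.
Let quad1 := E_quad_mx q_neq0 d_odd k0_neq0 k1_neq0 k2_neq0 k3_neq0 (r := 1) isT.
Let quad2 := E_quad_mx q_neq0 d_odd k0_neq0 k1_neq0 k2_neq0 k3_neq0 (r := 2) isT.
Let quad3 := E_quad_mx q_neq0 d_odd k0_neq0 k1_neq0 k2_neq0 k3_neq0 (r := 3) isT.
Let prodT := E_prod q_neq0 d_odd k0_neq0 k1_neq0 k2_neq0 k3_neq0 k0q.
Let T0v := T0_0 q d k0 k1 k2 k3.
Let T3v : T_ 3 *m v 0 = k3 *: v 0. Proof. by rewrite T3_even. Qed.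
Let quad1V : T_ 1 *m T_ 1 = (k1^-1 + k1^-1^-1) *: T_ 1 - 1%:M.
Proof. by rewrite quad1 /= invrK [k1 + _]addrC. Qed.

(** Built with k1 itself, the chain of v 0 is the given basis, and it stops
    since t_0 v_d = k0 v_d. *)
Lemma chain_E i : (i <= d.+1)%N ->
  chain q k0 k1 k3 (T_ 0) (T_ 2) (v 0) i = v i.
Proof.
elim: i => //= i IHi id; rewrite IHi; last exact: ltnW.
have [io|io] := boolP (odd i).
  move: id; rewrite ltnS leq_eqVlt => /predU1P[-> | id].
    rewrite T0_d // v_gt scalerA mulrAC -expr2 k0q mulVf ?expf_neq0 //.
    by rewrite scale1r subrr.
  rewrite T0_odd // scalerA (_ : _ * _ = 1) ?scale1r ?subKr //.
  by field; rewrite k0_neq0 expf_neq0.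
rewrite T2_even // scalerA (_ : _ * _ = 1) ?scale1r ?subKr //.
by field; rewrite k0_neq0 k1_neq0 k3_neq0 expf_neq0.
Qed.

Lemma X_unit : X \in unitmx.
Proof.
have /mulmx1_unit[] // : X *m (q *: (T_ 2 *m T_ 3)) = 1%:M.
by rewrite -scalemxAr mulmxA prodT scale_scalar_mx mulfV.
Qed.

Lemma XX_inj m (x : 'cV[F]_d.+1) : X ^+ m *m x = 0 -> x = 0.
Proof.
elim: m => [|m IHm]; first by rewrite mul1mx.
by rewrite exprS -mulmxE -mulmxA => /(congr1 (mulmx (invmx X)));
  rewrite mulmx0 mulKmx ?X_unit.
Qed.

Lemma horner_v i : (i <= d.+1)%N ->
  horner_mx X (chain_poly q k0 k1 i) *m v 0 = X ^+ uphalf i *m v i.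
Proof.
move=> id; rewrite -(chain_E id); symmetry.
exact: (chain_horner q_neq0 k0_neq0 k1_neq0 k2_neq0 k3_neq0 quad0 quad1 quad2
  quad3 prodT T0v T3v).
Qed.

(** By the symmetry of the polynomial of index d + 1, the chain built with k1^-1
    stops where the one built with k1 does. *)
Lemma chain_end : w d.+1 = 0.
Proof.
have dE : d.+1 = d.+1./2.*2 by rewrite -[LHS]odd_double_half /= d_odd.
apply: (@XX_inj (uphalf d.+1)).
rewrite (chain_horner q_neq0 k0_neq0 k1V_neq0 k2_neq0 k3_neq0 quad0 quad1V quad2
  quad3 prodT T0v T3v).
have [c] : exists c, chain_poly q k0 k1^-1 d.+1 = c *: chain_poly q k0 k1 d.+1.
  by rewrite dE; apply: chain_poly_inv; rewrite -?dE.
by move=> ->; rewrite horner_mxZ -scalemxAl horner_v // v_gt mulmx0 scaler0.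
Qed.

(** Each step of the chain applies t_0 or t_2, and the coefficient of v_(i+1) in
    t_0 v_i or t_2 v_i never vanishes. So the chain is a basis for all values of
    the parameters. *)
Lemma chain_triangular i (id : (i < d.+1)%N) :
  (forall j : 'I_d.+1, (i < j)%N -> w i j 0 = 0) /\ w i (Ordinal id) 0 != 0.
Proof.
elim: i id => [|i IHi] id.
  by split=> [j j0|]; rewrite /= mxE ?eqxx ?oner_eq0 // gtn_eqF.
have [wi0 wii] := IHi (ltnW id); rewrite /=.
have [r [c c0 Tr]] : exists r, exists2 c, c != 0 & 
  w i.+1 = w i - c *: (T r *m w i) /\ T r (Ordinal id) (Ordinal (ltnW id)) != 0.
  rewrite /=; have [io|io] := boolP (odd i).
    exists (inord 0), (k0 * q ^+ i.+1); first by rewrite mulf_neq0 ?expf_neq0.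
    split=> //; rewrite mxE inordK //= /E_t0 io.
    case: ifP => [/eqP i0|_]; first by rewrite i0 in io.
    rewrite ltn_eqF // !mxE eqxx gtn_eqF // sub0r mulrN1 oppr_eq0.
    by rewrite mulf_neq0 ?invr_eq0 ?expf_neq0.
  exists (inord 2), (k0 * k1^-1 * k3 * q ^+ i.+1).
    by rewrite mulf_neq0 ?expf_neq0 // !mulf_neq0.
  split=> //; rewrite mxE inordK //= /E_t2 (negPf io).
  rewrite !mxE eqxx gtn_eqF // sub0r mulrN1 oppr_eq0.
  by rewrite mulf_neq0 ?invr_eq0 ?expf_neq0 // !mulf_neq0 ?invr_eq0.
case: Tr => /= -> Tr; split=> [j ij|].
  rewrite !mxE wi0 1?ltnW // sub0r.
  have := E_T_mul_far q k0 k1 k2 k3 r ij wi0; rewrite mxE => ->.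
  by rewrite mulr0 oppr0.
rewrite mxE wi0 // add0r !mxE oppr_eq0 mulf_neq0 //.
have := E_T_mul_raise q k0 k1 k2 k3 r (j := Ordinal id)
  (i := Ordinal (ltnW id)) erefl wi0.
by rewrite mxE => ->; rewrite mulf_neq0.
Qed.

(** The matrix with columns w 0, ..., w d: it maps the basis of E for k1^-1 to
    the chain of v 0 in E for k1. *)
Definition flip : 'M[F]_d.+1 := \matrix_(j, i) w i j 0.

Lemma flip_v i : (i <= d.+1)%N -> flip *m v i = w i.
Proof.
rewrite leq_eqVlt => /predU1P[-> | id]; first by rewrite v_gt mulmx0 chain_end.
apply/colP=> j; rewrite !mxE (bigD1 (Ordinal id)) //= big1 => [|m mi].
  by rewrite !mxE eqxx mulr1 addr0.
by rewrite !mxE (_ : _ == i = false) ?mulr0 //; apply: negPf.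
Qed.

Lemma flip_unit : flip \in unitmx.
Proof.
rewrite unitmxE -det_tr det_trig; last first.
  apply/is_trig_mxP=> i j ij; rewrite !mxE.
  by have [w0 _] := chain_triangular (ltn_ord i); apply: w0.
rewrite unitfE; apply/prodf_neq0 => i _; rewrite !mxE.
have [_] := chain_triangular (ltn_ord i); rewrite (_ : Ordinal _ = i) //.
exact: val_inj.
Qed.

Let wT0_odd := chain_T0_odd k1^-1 k3 (T_ 0) (T_ 2) q_neq0 k0_neq0 (v 0).
Let wT0_even := chain_T0_even q_neq0 k0_neq0 k1V_neq0 k2_neq0 k3_neq0
  quad0 quad1V quad2 quad3 prodT T0v T3v.
Let wT1_even := chain_T1_even q_neq0 k0_neq0 k1V_neq0 k2_neq0 k3_neq0
  quad0 quad1V quad2 quad3 prodT T0v T3v.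
Let wT1_odd := chain_T1_odd q_neq0 k0_neq0 k1V_neq0 k2_neq0 k3_neq0
  quad0 quad1V quad2 quad3 prodT T0v T3v.
Let wT2_even := chain_T2_even (T_ 0) (T_ 2) q_neq0 k0_neq0 k1V_neq0 k3_neq0 (v 0).
Let wT2_odd := chain_T2_odd (T_ 0) q_neq0 k0_neq0 k1V_neq0 k2_neq0 k3_neq0 quad2 (v 0).
Let wT3_even := chain_T3_even q_neq0 k0_neq0 k1V_neq0 k2_neq0 k3_neq0
  quad0 quad1V quad2 quad3 prodT T0v T3v.
Let wT3_odd := chain_T3_odd q_neq0 k0_neq0 k1V_neq0 k2_neq0 k3_neq0
  quad0 quad1V quad2 quad3 prodT T0v T3v.

Lemma flip_intertwines r : T r *m flip = flip *m T' r.
Proof.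
apply: mx_eq_v => i; rewrite -!mulmxA => id; rewrite flip_v; last exact: leqW.
rewrite -[r]inord_val; case: r => [[|[|[|[|//]]]] lt4] /=; move: i id {lt4}.
- apply: i_cases => [||i io id].
  + by rewrite T0_0 -scalemxAr flip_v.
  + rewrite T0_d // -scalemxAr flip_v // wT0_odd // chain_end subr0.
    by congr (_ *: _); rewrite -k0q; field.
  + have io1 : ~~ odd i.+1 by rewrite negbK.
    split; first by rewrite T0_odd // -scalemxAr mulmxBr !flip_v ?wT0_odd //; lia.
    rewrite T0_even // mulmxDr -!scalemxAr !flip_v; try lia.
    by rewrite wT0_even // /even_coef !mulrA.
- case=> [|i] id.
    rewrite T1_0 mulmxDr -!scalemxAr !flip_v // wT1_even //.
    by rewrite /even_coef subrr mul0r mulr0 scale0r add0r.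
  have [io|io] := boolP (odd i); last first.
    by rewrite T1_odd // -scalemxAr flip_v ?wT1_odd //; lia.
  rewrite T1_even // !mulmxDr -!scalemxAr !flip_v; try lia.
  by rewrite wT1_even /even_coef /= ?negbK // !mulrA.
- apply: i_pairs => // i io id; split.
    by rewrite T2_even // -?scalemxAr ?mulmxBr ?flip_v ?wT2_even //; lia.
  rewrite T2_odd // !mulmxDr -!scalemxAr !flip_v; try lia.
  by rewrite wT2_odd.
- apply: i_pairs => // i io id; split.
    by rewrite T3_even // -?scalemxAr ?flip_v ?wT3_even //; lia.
  rewrite T3_odd // !mulmxDr -!scalemxAr !flip_v; try lia.
  by rewrite wT3_odd // /odd_coef !mulrA.
Qed.
End Flip.

(** * Irreducibility and the lowering coefficients *)

Lemma stable_preim (F : fieldType) n (T T' : 'I_4 -> 'M[F]_n) (A : 'M[F]_n) S :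
  (forall r, T r *m A = A *m T' r) -> stable T S ->
  stable T' [pred x | A *m x \in S].
Proof.
move=> TA stS; split=> [|a x y|r x]; rewrite !inE ?mulmx0; first by case: stS.
  by move=> xS yS; rewrite mulmxDr -scalemxAr (stableD stS) ?(stableZ stS).
by move=> xS; rewrite mulmxA -TA -mulmxA (stableT stS).
Qed.

Lemma irreducible_conj (F : fieldType) n (T T' : 'I_4 -> 'M[F]_n) (A : 'M[F]_n) :
  A \in unitmx -> (forall r, T r *m A = A *m T' r) ->
  irreducible_action T -> irreducible_action T'.
Proof.
move=> Au TA irrT S stS.
have TA' r : T' r *m invmx A = invmx A *m T r.
  by rewrite -[LHS](mulKmx Au) (mulmxA A (T' r)) -TA -[T r *m A *m _]mulmxA mulmxV // mulmx1.
have [S0 | S1] := irrT _ (stable_preim TA' stS); [left=> x xS | right=> x].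
  by apply: (can_inj (mulKmx Au)); rewrite mulmx0; apply: S0; rewrite inE mulKmx.
by have := S1 (A *m x); rewrite inE mulKmx.
Qed.

(** If the coefficient at i vanishes, the vectors without coordinates below i are
    a submodule, which contains v_d but not v_0. *)
Lemma lowering_coef_neq0 (F : fieldType) (q k0 k1 k2 k3 : F) d i :
  irreducible_action (E_T q d k0 k1 k2 k3) -> (0 < i <= d)%N ->
  lowering_coef q k0 k1 k2 k3 i != 0.
Proof.
case: i => // i irrT /= id; apply/eqP => c0.
pose i1 : 'I_d.+1 := Ordinal (id : (i.+1 < d.+1)%N).
pose S := [pred x : 'cV[F]_d.+1 | [forall j : 'I_d.+1, (j <= i)%N ==> (x j 0 == 0)]].
have SP (x : 'cV[F]_d.+1) : reflect (forall j : 'I_d.+1, (j <= i)%N -> x j 0 = 0) (x \in S).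
  by apply: (iffP forallP) => x0 j; [move=> ji; apply/eqP/(implyP (x0 j))
    | apply/implyP=> ji; rewrite x0].
have stS : stable (E_T q d k0 k1 k2 k3) S.
  split=> [|a x y /SP x0 /SP y0|r x /SP x0]; apply/SP=> j ji.
  - by rewrite mxE.
  - by rewrite !mxE x0 // y0 // mulr0 addr0.
  have x_lt (a : 'I_d.+1) : (a < i1)%N -> x a 0 = 0 by apply: x0.
  have [ji' | ij] := ltnP j i.
    rewrite mxE big1 // => a _; have [ai | ia] := leqP a i.
      by rewrite x0 // mulr0.
    by rewrite E_T_tridiagonal ?mul0r //; apply/orP; right; apply: leq_trans ia.
  have {}ji : j = i :> nat by apply/eqP; rewrite eqn_leq ji.
  by rewrite (E_T_mul_lower _ _ _ _ _ r (i := i1)) ?E_T_lower0 ?mul0r //= ?ji.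
have v0 j : E_v F d j 0 0 = (j == 0)%:R :> F by rewrite mxE eq_sym.
case: (irrT S stS) => [S0 | S1].
  have /S0/matrixP/(_ ord_max 0)/eqP : E_v F d d \in S.
    by apply/SP=> j ji; rewrite mxE ltn_eqF // (leq_ltn_trans ji).
  by rewrite !mxE eqxx oner_eq0.
by have /SP/(_ ord0 isT)/eqP := S1 (E_v F d 0); rewrite v0 oner_eq0.
Qed.

Section Sufficiency.
Variables (F : fieldType) (q : F) (d : nat) (k0 k1 k2 k3 : F).
Hypotheses (q_neq0 : q != 0) (d_odd : odd d).
Hypotheses (k0_neq0 : k0 != 0) (k1_neq0 : k1 != 0).
Hypotheses (k2_neq0 : k2 != 0) (k3_neq0 : k3 != 0).
Hypothesis k0q : k0 ^+ 2 = q ^- d.+1.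
Local Notation v := (E_v F d).
Local Notation T := (E_T q d k0 k1 k2 k3).
Local Notation T_ r := (E_T q d k0 k1 k2 k3 (inord r)).
Local Notation X := (T_ 0 *m T_ 1).
Local Notation W := (flip q d k0 k1 k2 k3).
Local Notation theta := (k0 * k1^-1).

Lemma X_last m : X ^+ m *m v d = theta ^+ m *: v d.
Proof.
elim: m => [|m IHm]; first by rewrite mul1mx scale1r.
rewrite exprS -mulmxE -mulmxA IHm -scalemxAr -mulmxA T1_odd // -scalemxAr.
by rewrite T0_d // !scalerA exprS; congr (_ *: _); ring.
Qed.

(** v 0 is a cyclic vector for X; multiplying by a power of X that serves for all
    basis vectors at once avoids inverting X. *)
Lemma krylov (u : 'cV[F]_d.+1) :
  exists g, X ^+ uphalf d *m u = horner_mx X g *m v 0.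
Proof.
exists (\sum_(i < d.+1) u i 0 *: ('X^(uphalf d - uphalf i) * chain_poly q k0 k1 i)).
rewrite rmorph_sum mulmx_suml.
rewrite {1}[u]E_v_sum mulmx_sumr; apply: eq_bigr => i _ /=.
rewrite horner_mxZ -scalemxAl -scalemxAr rmorphM rmorphXn /= horner_mx_X.
rewrite -mulmxE -mulmxA horner_v // 1?ltnW // mulmxA mulmxE -exprD subnK //.
by rewrite uphalf_leq // -ltnS.
Qed.

Lemma irreducible_action_E :
  (forall i, (0 < i <= d)%N -> lowering_coef q k0 k1 k2 k3 i != 0) ->
  (forall i, (0 < i <= d)%N -> lowering_coef q k0 k1^-1 k2 k3 i != 0) ->
  irreducible_action T.
Proof.
move=> low low' S stS.
have SX : {in S, forall x, X *m x \in S}.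
  by move=> x xS; rewrite -mulmxA !(stableT stS).
have SXn m : {in S, forall x, X ^+ m *m x \in S}.
  elim: m => [|m IHm] x xS; first by rewrite mul1mx.
  by rewrite exprS -mulmxE -mulmxA SX ?IHm.
have k1V : k1^-1 != 0 by rewrite invr_eq0.
have Wu := flip_unit d k2 q_neq0 k0_neq0 k1_neq0 k3_neq0.
have TW := flip_intertwines q_neq0 d_odd k0_neq0 k1_neq0 k2_neq0 k3_neq0 k0q.
have [[x xS x0] | S0] := pselect (exists2 x, x \in S & x != 0); last first.
  by left=> x xS; apply/eqP/negPn/negP => x0; apply: S0; exists x.
right; apply: (stable_last_full q_neq0 d_odd k0_neq0 k1_neq0 k2_neq0 k3_neq0 low stS).
have Wx : invmx W *m x != 0.
  by apply: contraNneq x0 => /(congr1 (mulmx W)); rewrite mulKVmx // mulmx0 => ->.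
have WxS : invmx W *m x \in [pred y | W *m y \in S] by rewrite inE mulKVmx.
have [u] := stable_first_coord q_neq0 d_odd k0_neq0 k1V k3_neq0 low'
  (stable_preim TW stS) WxS Wx.
rewrite inE => uS u0; pose e : 'rV[F]_d.+1 := delta_mx 0 0.
pose f := e *m invmx W.
have fX : f *m X = theta *: f.
  have WX : invmx W *m X = E_T q d k0 k1^-1 k2 k3 (inord 0)
      *m E_T q d k0 k1^-1 k2 k3 (inord 1) *m invmx W.
    apply: (can_inj (mulKmx Wu)); rewrite mulKVmx // !mulmxA -TW.
    by rewrite -[_ *m W *m _]mulmxA -TW !mulmxA mulmxK.
  by rewrite -mulmxA WX !mulmxA E_first_row0 -!scalemxAl E_first_row1 -scalemxAl scalerA.
have fv0 : f *m v 0 = 1%:M.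
  have W0 : W *m v 0 = v 0 by rewrite flip_v.
  by rewrite -[in LHS]W0 -mulmxA mulKmx // [e *m _]mx11_scalar -rowE !mxE.
(* f is the coordinate on the first vector of the second basis; evaluating it on
   both sides of the next equation shows that theta is not a root of g. *)
have [g gE] := krylov (W *m u); pose a := g.[theta].
have a0 : a != 0.
  have : a *: (f *m v 0) = theta ^+ uphalf d *: (e *m u).
    have fg : f *m horner_mx X g = a *: f := horner_left_eigen g fX.
    rewrite [LHS]scalemxAl -fg -mulmxA -gE !mulmxA.
    have := horner_left_eigen 'X^(uphalf d) fX.
    rewrite rmorphXn /= horner_mx_X hornerXn => ->.
    by rewrite -!scalemxAl /f mulmxKV.
  rewrite fv0 -rowE => /matrixP/(_ 0 0); rewrite !mxE mulr1 => ->.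
  by rewrite mulf_neq0 // expf_neq0 ?mulf_neq0.
have [h hE] : exists h, g - a%:P = h * ('X - theta%:P).
  by apply/factor_theorem; rewrite /root !hornerE subrr.
pose p := chain_poly q k0 k1.
have thetaE : 'X - theta%:P = - theta *: (1 - (k0 * k1 * q ^+ d.+1) *: 'X) :> {poly F}.
  rewrite scalerBr scalerA mulNr (_ : theta * _ = 1).
    by rewrite !scaleNr scale1r opprK addrC alg_polyC.
  transitivity (k0 ^+ 2 * q ^+ d.+1); first by field.
  by rewrite k0q mulVf ?expf_neq0.
(* Modulo p (d + 1), which annihilates v 0, multiplication by g acts on p d as
   the scalar g(theta). *)
have pg : p d * g = a *: p d + - theta *: (h * p d.+1).
  rewrite -[g](subrK a%:P) hE thetaE mulrDr -scalerAr -!scalerAr /p /= d_odd.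
  by rewrite [p d * a%:P]mulrC mul_polyC addrC [h * (_ * _)]mulrCA.
have hornerM_v r s : horner_mx X r *m (horner_mx X s *m v 0) = horner_mx X (r * s) *m v 0.
  by rewrite mulmxA rmorphM.
have hornerZD r s b c : horner_mx X (b *: r + c *: s) = b *: horner_mx X r + c *: horner_mx X s.
  by rewrite rmorphD /= !horner_mxZ.
have := stable_horner (p d) stS SX (SXn (uphalf d) _ uS).
rewrite gE hornerM_v pg hornerZD mulmxDl -!scalemxAl -hornerM_v !horner_v // v_gt.
rewrite !mulmx0 scaler0 addr0 X_last scalerA => vS.
have c0 : a * theta ^+ uphalf d != 0 by rewrite mulf_neq0 // expf_neq0 ?mulf_neq0.
by rewrite -[v d]scale1r -(mulVf c0) -scalerA (stableZ stS).
Qed.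
End Sufficiency.

Section Arithmetic.
Variables (F : fieldType) (q : F) (d : nat) (k0 k1 k2 k3 : F).
Hypotheses (q_neq0 : q != 0) (d_odd : odd d).
Hypotheses (k0_neq0 : k0 != 0) (k1_neq0 : k1 != 0).
Hypotheses (k2_neq0 : k2 != 0) (k3_neq0 : k3 != 0).

Lemma even_coef_neq0 i :
  (even_coef q k0 i != 0) = (q ^+ i != 1) && (k0 ^+ 2 != q ^- i).
Proof.
rewrite /even_coef mulf_eq0 negb_or !subr_eq0; congr (~~ _ && ~~ _).
  by rewrite eq_sym.
have qi : q ^+ i != 0 by rewrite expf_neq0.
by rewrite -[RHS](inj_eq (mulIf qi)) mulVf // eq_sym.
Qed.

Lemma odd_coef_neq0 i :
  (odd_coef q k0 k1 k2 k3 i != 0)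
    = (k0 * k1 * k2^-1 * k3 != q ^- i) && (k0 * k1 * k2 * k3 != q ^- i).
Proof.
have qi : q ^+ i != 0 by rewrite expf_neq0.
have shift (x y : F) : x != 0 -> (k0 * k1 * y * k3 == q ^- i)
    = (k0 * k1 * k3 * q ^+ i * y * x - x == 0).
  move=> x0; rewrite subr_eq0 -[RHS](inj_eq (mulIf (invr_neq0 x0))).
  rewrite divff // mulfK // -[LHS](inj_eq (mulIf qi)) mulVf //.
  by congr (_ == _); ring.
rewrite /odd_coef mulf_eq0 negb_or (shift k2) // (shift k2^-1) ?invr_eq0 //.
by rewrite divfK // mulfK.
Qed.

Hypothesis k0q : k0 ^+ 2 = q ^- d.+1.

(** The coefficient for k1^-1 at d + 1 - i gives the one condition at i that the
    coefficients at i do not. *)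
Lemma reflect_coef i : (i <= d.+1)%N ->
  (k0 * k1^-1 * k2^-1 * k3 == q ^- (d.+1 - i)) = (k0 * k1 * k2 * k3^-1 == q ^- i).
Proof.
move=> id; rewrite -(inj_eq invr_inj) invrK.
have qi : q ^- i != 0 by rewrite invr_eq0 expf_neq0.
have -> : q ^+ (d.+1 - i) = k0 ^- 2 * q ^- i.
  by rewrite k0q invrK -expfB_cond ?(negPf q_neq0).
have k0Vq : k0 ^- 2 != 0 by rewrite invr_eq0 expf_neq0.
rewrite -[RHS](inj_eq (mulfI k0Vq)); congr (_ == _).
by field; rewrite k0_neq0 k1_neq0 k2_neq0 k3_neq0.
Qed.
End Arithmetic.

Theorem theorem5p8 (F : fieldType) (q : F) (d : nat) (k0 k1 k2 k3 : F)
    (q_neq0 : q != 0) (d_odd : odd d)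
    (k0_neq0 : k0 != 0) (k1_neq0 : k1 != 0)
    (k2_neq0 : k2 != 0) (k3_neq0 : k3 != 0)
    (k0q : k0 ^+ 2 = q ^- d.+1) :
  irreducible_module
    (E q d k0 k1 k2 k3 q_neq0 d_odd k0_neq0 k1_neq0 k2_neq0 k3_neq0 k0q)
  <->
  [/\ forall i : nat, (2 <= i <= d.-1)%N -> ~~ odd i -> q ^+ i != 1,
      forall i : nat, (2 <= i <= d.-1)%N -> ~~ odd i -> k0 ^+ 2 != q ^- i
    & forall i : nat, (1 <= i <= d)%N -> odd i ->
        [/\ k0 * k1 * k2 * k3 != q ^- i,
            k0 * k1^-1 * k2 * k3 != q ^- i,
            k0 * k1 * k2^-1 * k3 != q ^- i
          & k0 * k1 * k2 * k3^-1 != q ^- i]].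
Proof.
have k1V : k1^-1 != 0 by rewrite invr_eq0.
split=> [/irreducible_moduleE irrT | [qi k0i ki]].
  have irrT' := irreducible_conj (flip_unit d k2 q_neq0 k0_neq0 k1_neq0 k3_neq0)
    (flip_intertwines q_neq0 d_odd k0_neq0 k1_neq0 k2_neq0 k3_neq0 k0q) irrT.
  have even_ok i : (2 <= i <= d.-1)%N -> ~~ odd i -> even_coef q k0 i != 0.
    move=> id /negPf io; have := lowering_coef_neq0 (i := i) irrT.
    by rewrite /lowering_coef io; apply; lia.
  split=> i id io.
  - by have := even_ok i id io; rewrite even_coef_neq0 // => /andP[].
  - by have := even_ok i id io; rewrite even_coef_neq0 // => /andP[].
  have := lowering_coef_neq0 irrT id; rewrite /lowering_coef io.
  rewrite odd_coef_neq0 // => /andP[-> ->].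
  have := lowering_coef_neq0 irrT' id; rewrite /lowering_coef io.
  rewrite odd_coef_neq0 // => /andP[_ ->].
  have id' : (1 <= d.+1 - i <= d)%N by lia.
  have io' : odd (d.+1 - i) by rewrite oddB /= ?d_odd ?io //; lia.
  have := lowering_coef_neq0 irrT' id'; rewrite /lowering_coef io'.
  by rewrite odd_coef_neq0 // reflect_coef //; [case/andP=> -> | lia].
apply/irreducible_moduleE/irreducible_action_E => // i id; rewrite /lowering_coef.
- have [io|io] := boolP (odd i).
    by rewrite odd_coef_neq0 //; have [-> _ -> _] := ki i id io.
  by rewrite even_coef_neq0 // qi ?k0i //; lia.
- have [io|io] := boolP (odd i); last first.
    by rewrite even_coef_neq0 // qi ?k0i //; lia.
  rewrite odd_coef_neq0 //; have [_ -> _ _] := ki i id io.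
  have id' : (1 <= d.+1 - i <= d)%N by lia.
  have io' : odd (d.+1 - i) by rewrite oddB /= ?d_odd ?io //; lia.
  have [_ _ _] := ki _ id' io'.
  rewrite -(reflect_coef q_neq0 k0_neq0 k1_neq0 k2_neq0 k3_neq0 k0q) ?leq_subr //.
  by rewrite subKn ?andbT //; lia.
Qed.
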